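(* Let $X=(X_s)_{s\in[0,T]}$ be a centered continuous Gaussian process which is a Markov process and whose covariance function satisfies $R_X(s,t)=\mathbb E X_sX_t\neq0$ for all $0<s,t<T$. Let $A=\{a_1,\dots,a_N\}\subset C([0,T])^*$ be a finite set of conditions, let $X^{(A)}$ be the conditioned process of $X$ with respect to $A$, and define $$I^{(A),i}_s=\int_0^s X^{(A)}_x\,a_i(dx),\qquad 0\le s\le T,\ 1\le i\le N.$$ Then the Gaussian process $(X^{(A)},I^{(A),1},\dots,I^{(A),N})$ is an $(N+1)$-dimensional (in general time-inhomogeneous) Markov process.
   Context: $C([0,T])$ is the Banach space of continuous real functions on $[0,T]$ with the supremum norm. A condition is an element $a$ of $C([0,T])^*$, identified with a finite signed Borel measure on $[0,T]$, $a(f)=\int f\,da$. The integral $\int_0^s\cdot\,a_i(dx)$ is over the closed interval $[0,s]$. Markov property is with respect to the natural filtration of the process. The conditioned process $X^{(A)}$ (defined only in law) is a continuous Gaussian process such that for all $b_1,\dots,b_n\in C([0,T])^*$ the law of $(b_1(X^{(A)}),\dots,b_n(X^{(A)}))$ is the conditional law of the Gaussian vector $(b_1(X),\dots,b_n(X))$ given $a(X)=0$ for all $a\in A$ in the sense of Gaussian conditioning, i.e. the law of $\big(b_k(X)-\mathbb E[b_k(X)\mid a(X),a\in A]\big)_{k=1}^n$. *)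

(* Defs.v *)
(* A process on [0, T] is a function R -> Omega -> _ of which only the values at
   times in [0, T] matter. *)
From HB Require Import structures.
From mathcomp Require Import all_boot all_order all_algebra.
From mathcomp Require Import all_classical all_reals all_analysis.

Set Implicit Arguments.
Unset Strict Implicit.
Unset Printing Implicit Defensive.

Import Order.TTheory GRing.Theory Num.Theory.
Import numFieldNormedType.Exports.

Local Open Scope classical_set_scope.
Local Open Scope ring_scope.

(* The library's normal_prob m 0 is the uniform law on [m, m + 1] by convention,
   hence the separate degenerate case. *)
Definition gaussian_law (R : realType) (m s : R) : set R -> \bar R :=
  if s == 0 then dirac m else normal_prob m s.

Section gaussian.
Context (R : realType) (d : measure_display) (Omega : measurableType d)
  (P : probability Omega R).

Definition gaussian_rv (Z : Omega -> R) : Prop :=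
  measurable_fun setT Z /\
  exists m s : R, forall B : set R, measurable B ->
    pushforward P Z B = gaussian_law m s B.

Definition gaussian_family (I : Type) (D : set I) (Z : I -> Omega -> R) : Prop :=
  forall (n : nat) (i : 'I_n -> I) (c : 'I_n -> R), (forall k, D (i k)) ->
    gaussian_rv (fun w => \sum_(k < n) c k * Z (i k) w).

Definition continuous_gaussian_process (T : R) (X : R -> Omega -> R) : Prop :=
  gaussian_family `[0, T] X /\
  forall w, {within `[0, T], continuous (X ^~ w)}.

Definition gaussian_vector_process (T : R) (n : nat)
    (V : R -> Omega -> n.-tuple R) : Prop :=
  gaussian_family (`[0, T] `*` [set: 'I_n])
    (fun p : R * 'I_n => fun w => tnth (V p.1 w) p.2).

Definition centered (T : R) (X : R -> Omega -> R) : Prop :=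
  forall t : R, t \in `[0, T] -> ('E_P[X t] = 0)%E.

Definition cov_fun (X : R -> Omega -> R) (s t : R) : \bar R :=
  'E_P[(X s \* X t)%R]%E.

End gaussian.

Section conditional_expectation.
Context (R : realType) (d : measure_display) (Omega : measurableType d)
  (P : probability Omega R).

Definition sigma_family (d' : measure_display) (E : measurableType d')
    (I : Type) (D : set I) (Z : I -> Omega -> E) : set (set Omega) :=
  <<s \bigcup_(i in D) g_sigma_algebra_preimage (Z i) >>.

(* Z is a version of E[Y | G]; meant for a sub-sigma-algebra G *)
Definition is_cond_exp (G : set (set Omega)) (Y Z : Omega -> R) : Prop :=
  [/\ P.-integrable setT (EFin \o Y),
      P.-integrable setT (EFin \o Z),
      g_sigma_algebra_preimage Z `<=` G &
      forall A, G A -> (\int[P]_(w in A) (Z w)%:E = \int[P]_(w in A) (Y w)%:E)%E].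

(* P(V_t \in B | F_s) = P(V_t \in B | V_s) a.s., F the natural filtration of V,
   expressed as the existence of a common version. *)
Definition markov_process (d' : measure_display) (E : measurableType d')
    (T : R) (V : R -> Omega -> E) : Prop :=
  (forall t : R, t \in `[0, T] -> measurable_fun setT (V t)) /\
  forall (s t : R) (B : set E), 0 <= s -> s <= t -> t <= T -> measurable B ->
    exists Z : Omega -> R,
      is_cond_exp (sigma_family `[0, s] V) (\1_(V t @^-1` B)) Z /\
      is_cond_exp (g_sigma_algebra_preimage (V s)) (\1_(V t @^-1` B)) Z.

End conditional_expectation.

(* A condition, i.e. an element of C([0, T])^*, is a finite signed Borel measure.
   It is represented by a charge on R, of which only the restriction to [0, T]
   is ever used. *)
Definition condition (R : realType) : Type :=
  {charge set (measurableTypeR R) -> \bar R}.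

(* The integral does not depend on the chosen Hahn decomposition. *)
Definition charge_integral (R : realType) (a : condition R) (D : set R)
    (f : R -> R) : R :=
  let exN := projT2 (cid (Hahn_decomposition a)) in
  let aPN := projT2 (cid exN) in
  Rintegral (jordan_pos aPN) D f - Rintegral (jordan_neg aPN) D f.

Section conditioning.
Context (R : realType) (T : R).

Definition apply_condition (d : measure_display) (Omega : measurableType d)
    (a : condition R) (X : R -> Omega -> R) : Omega -> R :=
  fun w => charge_integral a `[0, T] (X ^~ w).

(* Y, possibly on another probability space, has the law of X conditioned on
   a_i(X) = 0 for all i. *)
Definition is_conditioned_process
    (d : measure_display) (Omega : measurableType d) (P : probability Omega R)
    (X : R -> Omega -> R) (N : nat) (a : 'I_N -> condition R)
    (d' : measure_display) (Omega' : measurableType d')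
    (P' : probability Omega' R) (Y : R -> Omega' -> R) : Prop :=
  continuous_gaussian_process P' T Y /\
  forall (n : nat) (b : 'I_n -> condition R),
    exists Z : 'I_n -> Omega -> R,
      (forall k, is_cond_exp P
         (sigma_family setT (fun i => apply_condition (a i) X))
         (apply_condition (b k) X) (Z k)) /\
      forall B : set (n.-tuple R), measurable B ->
        pushforward P'
          (fun w => [tuple apply_condition (b k) Y w | k < n]) B =
        pushforward P
          (fun w => [tuple apply_condition (b k) X w - Z k w | k < n]) B.

Definition running_integral (d : measure_display) (Omega : measurableType d)
    (a : condition R) (Y : R -> Omega -> R) (s : R) : Omega -> R :=
  fun w => charge_integral a `[0, s] (Y ^~ w).

Definition augmented_process (d : measure_display) (Omega : measurableType d)
    (N : nat) (a : 'I_N -> condition R) (Y : R -> Omega -> R) :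
    R -> Omega -> (N.+1).-tuple R :=
  fun s w => [tuple of Y s w ::
                       [tuple running_integral (a i) Y s w | i < N]].

End conditioning.

(* Main.v *)
(* Everything is linear algebra in Gaussian spaces, i.e. linear spaces of
   centered Gaussian variables, where orthogonal subspaces generate independent
   sigma-algebras.  Laws are handled through the integrals of
   w |-> sin (th + f w), f in the space: they determine every event generated by
   the space.

   The law of X^(A) is that of the residuals b(X) - E[b(X) | a(X), a in A], so
   the covariances of b(X^(A)) are those of the residuals in the Gaussian space
   of X.  Let s <= t.  By the Markov property of X, a variable of the future of
   s has on X_x, x <= s, the same covariances as a multiple of X_s.  The integral
   of X against a_i over [0, t] or [0, T] is its integral over [0, s] plus a
   variable of the future of s, so on the past of s the residual of each
   component of V_t = (X_t, I^1_t, ..., I^N_t) acts like a linear function of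
   V_s.  Regress it on the residuals of the components of V_s: the remainder is
   orthogonal to the components of V_s, hence to the past of s.  On the
   conditioned side this reads V_t = L V_s + W with W independent of the past of
   s, which is the Markov property. *)
Require Import Defs.
From HB Require Import structures.
From mathcomp Require Import all_boot all_order all_algebra.
From mathcomp Require Import all_classical all_reals all_analysis.
From mathcomp Require Import measurable_realfun ring lra.

Set Implicit Arguments.
Unset Strict Implicit.
Unset Printing Implicit Defensive.

Import Order.TTheory GRing.Theory Num.Theory.
Import numFieldNormedType.Exports.
Import HBSimple HBNNSimple.

Local Open Scope classical_set_scope.
Local Open Scope ring_scope.

(** The conditioned process is known only through its law, so nothing about it can be computed path
    by path. What crosses over is the covariance form, by polarization of the variances of
    combinations. Hence the Markov property of X is first turned into an identity between
    covariances, and events come back only at the end, through independence.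

    No Hilbert space is completed. Paths are continuous, so an integral against a condition is, for
    every outcome, a limit of Riemann sums, and pointwise limits of centred Gaussian variables are
    centred Gaussian with convergent variances. Projections are onto finitely many variables whose
    Gram matrix may be singular.

    The remainder Q of the regression is orthogonal to each component of V_s because that component
    is its residual plus a combination of the a_i(X), to which all residuals are orthogonal. It is
    then orthogonal to the past because there it acts like some L in the span of V_s, and L is
    itself a limit of combinations of the past: <L, L> = <Q, L> = 0. *)

(** * Bounded functionals *)

Section bounded_functionals.
Context (R : realType) (d : measure_display) (T : measurableType d).

Definition bmf (f : T -> R) : Prop :=
  measurable_fun setT f /\ exists C, forall x, `|f x| <= C.

Lemma bmf_cst c : bmf (cst c).
Proof. by split; [exact: measurable_cst | exists `|c|]. Qed.

Lemma bmfD f g : bmf f -> bmf g -> bmf (f + g).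
Proof.
move=> [mf [C fC]] [mg [D gD]]; split; first exact: measurable_funD.
by exists (C + D) => x; rewrite (le_trans (ler_normD _ _))// lerD.
Qed.

Lemma bmfZ c f : bmf f -> bmf (c *: f).
Proof.
move=> [mf [C fC]]; split; first exact: measurable_funM.
by exists (`|c| * C) => x; rewrite normrM ler_wpM2l.
Qed.

Lemma bmfM f g : bmf f -> bmf g -> bmf (f \* g).
Proof.
move=> [mf [C fC]] [mg [D gD]]; split; first exact: measurable_funM.
by exists (C * D) => x; rewrite normrM ler_pM.
Qed.

Lemma measurable_sin (f : T -> R) : measurable_fun setT f ->
  measurable_fun setT (fun x => sin (f x)).
Proof.
have msin := continuous_measurable_fun (@continuous_sin R).
by move=> mf; exact: (measurableT_comp msin mf).
Qed.

Lemma bmf_sin f : measurable_fun setT f -> bmf (fun x => sin (f x)).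
Proof.
move=> mf; split; first exact: measurable_sin.
by exists 1 => x; rewrite sin_max.
Qed.

Lemma bmf_indic A : measurable A -> bmf (\1_A : T -> R).
Proof.
move=> mA; split; first exact: measurable_indic.
by exists 1 => x; rewrite indicE; case: (_ \in _); rewrite ?normr1 ?normr0.
Qed.

Definition bounded_cvg (f_ : nat -> T -> R) (f : T -> R) : Prop :=
  [/\ forall n, measurable_fun setT (f_ n),
      exists C, forall n x, `|f_ n x| <= C &
      forall x, f_ n x @[n --> \oo] --> f x].

Lemma bounded_cvg_bmf f_ f : bounded_cvg f_ f -> bmf f.
Proof.
move=> [mf [C fC] cf]; split.
  by apply: (measurable_fun_cvg mf) => x _; exact: cf.
exists C => x; have cfx : `|f_ n x| @[n --> \oo] --> `|f x| by exact: cvg_norm.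
rewrite -(cvg_lim _ cfx)//; apply: limr_le; last exact: nearW.
by apply/cvg_ex; exists `|f x|.
Qed.

Lemma bounded_cvgM g f_ f : bmf g -> bounded_cvg f_ f ->
  bounded_cvg (fun n => g \* f_ n) (g \* f).
Proof.
move=> [mg [D gD]] [mf [C fC] cf]; split.
- by move=> n; exact: measurable_funM.
- by exists (D * C) => n x; rewrite normrM ler_pM.
- by move=> x; apply: cvgM; [exact: cvg_cst | exact: cf].
Qed.

(** Common abstraction of an integral against a law, a difference of two laws, and an integral with
    an integrable weight. Every uniqueness statement below takes the form that such a [Phi]
    vanishes. *)
Definition bounded_functional (Phi : (T -> R) -> R) : Prop :=
  (forall c f g, bmf f -> bmf g -> Phi (c *: f + g) = c * Phi f + Phi g) /\
  (forall f_ f, bounded_cvg f_ f -> Phi (f_ n) @[n --> \oo] --> Phi f).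

Lemma bounded_functional0 Phi : bounded_functional Phi -> Phi 0 = 0.
Proof.
move=> [lin _]; have b0 := bmf_cst 0.
have := lin 1 _ _ b0 b0; rewrite scale1r addr0 mul1r => /eqP.
by rewrite -subr_eq0 opprD addNKr oppr_eq0 => /eqP.
Qed.

Lemma bounded_functionalZ Phi c f : bounded_functional Phi -> bmf f ->
  Phi (c *: f) = c * Phi f.
Proof.
move=> bPhi bf; have := bPhi.1 c f 0 bf (bmf_cst 0).
by rewrite bounded_functional0// !addr0.
Qed.

Lemma bounded_functional_lim0 Phi f_ f : bounded_functional Phi ->
  bounded_cvg f_ f -> (forall n, Phi (f_ n) = 0) -> Phi f = 0.
Proof.
move=> [_ cP] /cP + f0; under eq_fun do rewrite f0.
by move=> /cvg_lim <- //; rewrite lim_cst.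
Qed.

Lemma bounded_functionalB Phi Psi : bounded_functional Phi ->
  bounded_functional Psi -> bounded_functional (fun f => Phi f - Psi f).
Proof.
move=> [l1 c1] [l2 c2]; split => [c f g bf bg|f_ f bcf].
  by rewrite l1// l2//; ring.
by apply: cvgB; [exact: c1|exact: c2].
Qed.

Lemma bounded_functional_sum Phi I (r : seq I) (c : I -> R) (g : I -> T -> R) :
  bounded_functional Phi -> (forall i, bmf (g i)) ->
  bmf (\sum_(i <- r) c i *: g i) /\
  Phi (\sum_(i <- r) c i *: g i) = \sum_(i <- r) c i * Phi (g i).
Proof.
move=> bPhi bg; elim: r => [|i r [bs IH]].
  by rewrite !big_nil; split; [exact: bmf_cst|exact: bounded_functional0].
by rewrite !big_cons -IH bPhi.1//; split => //; apply: bmfD => //; exact: bmfZ.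
Qed.

Lemma bounded_functional_indic Phi f : bounded_functional Phi -> bmf f ->
  (forall B : set R, measurable B -> Phi \1_(f @^-1` B) = 0) -> Phi f = 0.
Proof.
(* Adding the bound [C] makes [f] nonnegative, so that simple functions of [f + C] approximate it
   from below. The absolute value only matters off the range of [f]. *)
move=> bPhi bf Phi0; have [mf [C fC]] := bf.
have mh : measurable_fun setT (fun y : R => `|y + C|%:E).
  apply/measurable_EFinP; apply: measurableT_comp => //.
  exact: measurable_funD.
have h0 (y : R) : setT y -> (0 <= `|y + C|%:E)%E.
  by rewrite lee_fin.
pose h n : R -> R := nnsfun_approx measurableT mh n.
have mhn n : measurable_fun setT (h n).
  exact: measurable_funPT.
have hC y : h n y @[n --> \oo] --> `|y + C|.
  exact: (fine_cvg (cvg_nnsfun_approx measurableT mh h0 (I : setT y))).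
have h_ge0 n y : 0 <= h n y by rewrite /h; exact: fun_ge0.
have h_le n y : h n y <= `|y + C|.
  rewrite -(cvg_lim _ (hC y))//; apply: nondecreasing_cvgn_le.
    by move=> i j ij; have /lefP := nd_nnsfun_approx measurableT mh ij; exact.
  by apply/cvg_ex; eexists; exact: hC.
have Phih n : Phi (h n \o f) = 0.
  have [r rE] : exists r : seq R,
      h n \o f = \sum_(y <- r) y *: (\1_(f @^-1` (h n @^-1` [set y])) : T -> R).
    exists (finmap.enum_fset (fset_set (range (h n)))); apply/funext => x.
    by rewrite fct_sumE /= /h fimfunE fsbig_finite.
  rewrite rE (bounded_functional_sum _ _ bPhi _).2; last first.
    by move=> y; apply: bmf_indic; rewrite -[X in measurable X]setTI; exact: mf.
  by rewrite big1// => y _; rewrite Phi0 ?mulr0.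
have : Phi (f + cst C) = 0.
  apply: (bounded_functional_lim0 bPhi _ Phih); split.
  - by move=> n; exact: (measurableT_comp (mhn n) mf).
  - exists (C + `|C|) => n x /=; rewrite ger0_norm ?h_ge0//.
    by rewrite (le_trans (h_le _ _))// (le_trans (ler_normD _ _))// lerD2r.
  - move=> x; rewrite fctE /= -[X in _ --> X]ger0_norm; first exact: hC.
    by have := fC x; rewrite ler_norml; lra.
(* The constant [C] is [C] times the indicator of the preimage of [setT], so [Phi] kills it too and
   the shift can be undone. *)
have b1 : bmf (\1_(f @^-1` setT) : T -> R) by apply: bmf_indic; rewrite preimage_setT.
have := bPhi.1 C _ _ b1 bf; rewrite Phi0// mulr0 add0r => <-; congr (Phi _ = 0).
by apply/funext => x; rewrite !fctE preimage_setT indicT addrC /GRing.scale /= mulr1.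
Qed.

End bounded_functionals.

Section integral_functional.
Context (R : realType) (d : measure_display) (T : measurableType d)
  (P : {measure set T -> \bar R}).

Lemma bmf_integrableM (f k : T -> R) : bmf f -> P.-integrable setT (EFin \o k) ->
  P.-integrable setT (EFin \o (f \* k)).
Proof.
move=> [mf [C fC]] ik.
have mk := measurable_int P ik.
apply: (@le_integrable _ _ _ P _ _ _ (fun x => C%:E * (EFin \o k) x)%E) => //.
- apply/measurable_EFinP; apply: measurable_funM => //.
  exact/measurable_EFinP.
- move=> x _ /=; rewrite lee_fin !normrM ler_wpM2r//.
  by rewrite (le_trans (fC x))// ler_norm.
- exact: integrableZl.
Qed.

Lemma Rintegral_bounded_functional (k : T -> R) :
  P.-integrable setT (EFin \o k) ->
  bounded_functional (fun f => \int[P]_x (f x * k x)).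
Proof.
move=> ik; split => [c f g bf bg|f_ f [mf [C fC] cf]].
  have ifk := bmf_integrableM bf ik; pose fk := f \* k.
  rewrite -RintegralZl//.
  rewrite -RintegralD//; last 2 first.
  - rewrite (_ : EFin \o _ = (fun x => c%:E * (EFin \o fk) x)%E)//.
    exact: integrableZl.
  - exact: bmf_integrableM.
  by apply: eq_Rintegral => x _; rewrite !fctE mulrDl -mulrA.
have mk : measurable_fun setT k by apply/measurable_EFinP; exact: measurable_int ik.
have bf : bmf f by apply: (@bounded_cvg_bmf _ _ _ f_); split => //; exists C.
apply: fine_cvg; rewrite fineK; last first.
  by apply: integrable_fin_num => //; exact: bmf_integrableM.
have [] := @dominated_convergence _ _ _ P setT measurableT
  (fun n x => (f_ n x * k x)%:E) (fun x => (f x * k x)%:E)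
  (fun x => C%:E * (abse \o (EFin \o k)) x)%E.
- by move=> n; apply/measurable_EFinP; exact: measurable_funM.
- by apply/measurable_EFinP; apply: measurable_funM => //; exact: bf.1.
- apply: aeW => x _; apply: cvg_EFin; first exact: nearW.
  by apply: cvgM; [exact: cf | exact: cvg_cst].
- by apply: integrableZl => //; exact: integrable_abse.
- by apply: aeW => x n _ /=; rewrite lee_fin normrM ler_wpM2r.
- by [].
Qed.

End integral_functional.

Section finite_integral_functional.
Context (R : realType) (d : measure_display) (T : measurableType d)
  (P : probability T R).

Lemma bmf_integrable (f : T -> R) : bmf f -> P.-integrable setT (EFin \o f).
Proof.
move=> bf; have i1 : P.-integrable setT (EFin \o cst (1 : R)).
  exact: finite_measure_integrable_cst.
have := bmf_integrableM bf i1; rewrite (_ : f \* _ = f)//.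
by apply/funext => x /=; rewrite mulr1.
Qed.

Lemma Rintegral_bounded_functional1 :
  bounded_functional (fun f => \int[P]_x f x).
Proof.
have i1 : P.-integrable setT (EFin \o cst (1 : R)).
  exact: finite_measure_integrable_cst.
have := Rintegral_bounded_functional i1.
rewrite (_ : (fun f => _) = (fun f : T -> R => \int[P]_x f x))//.
by apply/funext => f; apply: eq_Rintegral => x _ /=; rewrite mulr1.
Qed.

End finite_integral_functional.

(** * Uniqueness from trigonometric integrals *)

Section sign_iteration.
Context (R : realType).

(* On [-1, 1] the iterates of this polynomial converge to the sign function. *)
Definition sgstep (u : R) : R := (3 * u - u ^+ 3) / 2.

Lemma iter_sgstepN n u : iter n sgstep (- u) = - iter n sgstep u.
Proof. by elim: n => //= n ->; rewrite /sgstep; field. Qed.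

(** One step multiplies the distance 1 - w to the limit by 1 - w/2 - w^2/2, and this factor is at
    most 1 - u/2 because the iterates never fall below u. *)
Lemma iter_sgstep_itv n (u : R) : 0 <= u <= 1 ->
  u <= iter n sgstep u <= 1 /\ 1 - iter n sgstep u <= (1 - u / 2) ^+ n.
Proof.
move=> /andP[u0 u1]; elim: n => [|n [/andP[]]] /=.
  by rewrite lexx u1 expr0; split => //; lra.
rewrite exprSr; set w := iter n _ _; set z := _ ^+ n => uw w1 wz.
have s1 : 1 - sgstep w = (1 - w) * (1 - w / 2 - w ^+ 2 / 2).
  by rewrite /sgstep; field.
have s2 : sgstep w - w = w * (1 - w ^+ 2) / 2 by rewrite /sgstep; field.
have w2 : w ^+ 2 <= 1 by rewrite expr_le1//; lra.
have ws : w <= sgstep w.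
  by rewrite -subr_ge0 s2 divr_ge0// mulr_ge0//; lra.
have w2' : w ^+ 2 <= w by rewrite expr2 ler_piMl//; lra.
split.
  rewrite (le_trans uw ws)/= -subr_ge0 s1 mulr_ge0//; lra.
rewrite s1 ler_pM//; [lra|lra|].
have := sqr_ge0 w; lra.
Qed.

Lemma cvg_iter_sgstep (u : R) : `|u| <= 1 ->
  iter n sgstep u @[n --> \oo] --> Num.sg u.
Proof.
have pos v : 0 < v -> v <= 1 -> iter n sgstep v @[n --> \oo] --> (1 : R).
  move=> v0 v1; have v01 : 0 <= v <= 1 by rewrite ltW.
  apply: (@squeeze_cvgr _ _ _ _ (fun n => 1 - (1 - v / 2) ^+ n) (cst 1)).
  - apply: nearW => n; have [/andP[_ ->]] := iter_sgstep_itv n v01.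
    by rewrite andbT; lra.
  - rewrite -[X in _ --> X]subr0; apply: cvgB; first exact: cvg_cst.
    by apply: cvg_expr; rewrite ger0_norm; lra.
  - exact: cvg_cst.
rewrite ler_norml => /andP[uN1 u1]; have [u0|u0|u0] := ltgtP 0 u; last rewrite -u0.
- by rewrite gtr0_sg//; exact: pos.
- rewrite ltr0_sg//.
  have -> : (fun n => iter n sgstep u) = (fun n => - iter n sgstep (- u)).
    by apply/funext => n; rewrite iter_sgstepN opprK.
  by apply: cvgN; apply: pos; lra.
- rewrite sgr0; have -> : (fun n => iter n sgstep (0 : R)) = cst 0.
    by apply/funext => n /=; elim: n => //= n ->; rewrite /sgstep; field.
  exact: cvg_cst.
Qed.

End sign_iteration.

Section trig_uniqueness.
Context (R : realType) (d : measure_display) (T : measurableType d).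

Definition linear_subspace (S : set (T -> R)) : Prop :=
  S 0 /\ forall c f g, S f -> S g -> S (c *: f + g).

Lemma subspaceZ S c f : linear_subspace S -> S f -> S (c *: f).
Proof. by move=> [S0 lin] Sf; rewrite -[_ *: _]addr0; exact: lin. Qed.

Lemma subspaceD S f g : linear_subspace S -> S f -> S g -> S (f + g).
Proof. by move=> [S0 lin] Sf Sg; rewrite -[f]scale1r; exact: lin. Qed.

Lemma subspaceB S f g : linear_subspace S -> S f -> S g -> S (f - g).
Proof.
by move=> lS Sf Sg; apply: subspaceD => //; rewrite -scaleN1r; exact: subspaceZ.
Qed.

Lemma subspace_sum S n (f : 'I_n -> T -> R) : linear_subspace S ->
  (forall i, S (f i)) -> S (\sum_i f i).
Proof.
move=> lS Sf; elim/big_ind: _ => [|g h Sg Sh|i _]; [exact: lS.1| |exact: Sf].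
exact: subspaceD.
Qed.

Context (Phi : (T -> R) -> R) (S : set (T -> R)).
Hypothesis bPhi : bounded_functional Phi.
Hypothesis linS : linear_subspace S.
Hypothesis mS : forall f, S f -> measurable_fun setT f.
Hypothesis Phi0 : forall f th, S f -> Phi (fun x => sin (th + f x)) = 0.

Let trig_null h :=
  bmf h /\ forall f th, S f -> Phi (fun x => h x * sin (th + f x)) = 0.

(* The multipliers g preserving [trig_null] form an algebra that is closed under
   bounded pointwise limits, so the events whose indicator is a multiplier form
   a sigma-algebra. *)
Let trig_mult g := bmf g /\ forall h, trig_null h -> trig_null (h \* g).

Let msinD th f : S f -> bmf (fun x => sin (th + f x)).
Proof.
by move=> Sf; apply: bmf_sin; apply: measurable_funD => //; exact: mS.
Qed.

Let trig_mult1 : trig_mult (cst 1).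
Proof.
split; first exact: bmf_cst.
move=> h; rewrite (_ : h \* _ = h)//.
by apply/funext => x /=; rewrite mulr1.
Qed.

Let trig_multL c f g : trig_mult f -> trig_mult g -> trig_mult (c *: f + g).
Proof.
move=> [bf nf] [bg ng]; split; first by apply: bmfD => //; exact: bmfZ.
move=> h nh; split.
  by apply: bmfM; [exact: nh.1|apply: bmfD => //; exact: bmfZ].
move=> e th Se; have [bhf /(_ e th Se) hf0] := nf _ nh.
have [bhg /(_ e th Se) hg0] := ng _ nh.
have := bPhi.1 c _ _ (bmfM bhf (msinD th Se)) (bmfM bhg (msinD th Se)).
rewrite hf0 hg0 mulr0 addr0 => <-; congr Phi.
by apply/funext => x; rewrite !fctE /GRing.scale /=; ring.
Qed.

Let trig_multM f g : trig_mult f -> trig_mult g -> trig_mult (f \* g).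
Proof.
move=> [bf nf] [bg ng]; split; first exact: bmfM.
move=> h /nf /ng; rewrite (_ : (h \* f) \* g = h \* (f \* g))//.
by apply/funext => x /=; rewrite mulrA.
Qed.

Let trig_mult_cvg f_ f : bounded_cvg f_ f -> (forall n, trig_mult (f_ n)) ->
  trig_mult f.
Proof.
move=> bcf mf; have bf := bounded_cvg_bmf bcf; split=> // h nh.
split; first by apply: bmfM => //; exact: nh.1.
move=> e th Se; apply: (@bounded_functional_lim0 _ _ _ _
  (fun n x => h x * f_ n x * sin (th + e x))) => //; last first.
  by move=> n; have [_ /(_ h nh)[_ ->]] := mf n.
have := bounded_cvgM (bmfM nh.1 (msinD th Se)) bcf.
congr bounded_cvg; [apply/funext => n|]; apply/funext => x /=; ring.
Qed.

(** A product of two sines is half a difference of cosines of the difference and of the sum of the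
    arguments. Both arguments come from [S], and a shift of the phase by pi/2 turns the cosines back
    into sines. *)
Let trig_mult_sin f th : S f -> trig_mult (fun x => sin (th + f x)).
Proof.
move=> Sf; split; first exact: msinD.
move=> h nh; split; first by apply: bmfM; [exact: nh.1|exact: msinD].
move=> e eta Se.
have SD : S (f + e) by exact: subspaceD.
have SB : S (f - e) by exact: subspaceB.
have b1 := bmfM nh.1 (msinD (th - eta + pi / 2) SB).
have b2 := bmfM nh.1 (msinD (th + eta + pi / 2) SD).
have := bPhi.1 (2^-1) _ _ b1 (bmfZ (- 2^-1) b2).
rewrite (bounded_functionalZ (- 2^-1) bPhi b2).
rewrite (nh.2 (f - e) _ SB) (nh.2 (f + e) _ SD) !mulr0 addr0 => <-; congr Phi.
apply/funext => x; rewrite !fctE /GRing.scale /=.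
rewrite (_ : th - eta + _ + _ = (th + f x) - (eta + e x) + pi / 2); last by ring.
rewrite (_ : th + eta + _ + _ = (th + f x) + (eta + e x) + pi / 2); last by ring.
rewrite !sinDpihalf.
set u := th + f x; set v := eta + e x; rewrite cosB cosD; by field.
Qed.

Let trig_mult_sg g : (forall x, `|g x| <= 1) -> trig_mult g ->
  trig_mult (fun x => Num.sg (g x)).
Proof.
move=> g1 mg.
have miter n : trig_mult (fun x => iter n (@sgstep R) (g x)).
  elim: n => //= n; set w := fun x => iter _ _ _ => mw.
  have := trig_multL (- 2^-1) (trig_multM mw (trig_multM mw mw))
    (trig_multL (3 / 2 - 1) mw mw).
  congr trig_mult; apply/funext => x.
  by rewrite !fctE /GRing.scale /= /sgstep /w; field.
apply: (trig_mult_cvg _ miter); split.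
- by move=> n; exact: (miter n).1.1.
- exists 1 => n x; have := g1 x; rewrite !ler_norml => /andP[gN1 g1'].
  have [g0|g0] := leP 0 (g x).
    have /(iter_sgstep_itv n)[/andP[? ?] _] : 0 <= g x <= 1 by lra.
    by lra.
  have /(iter_sgstep_itv n)[+ _] : 0 <= - g x <= 1 by lra.
  by rewrite iter_sgstepN => /andP[? ?]; lra.
- by move=> x; exact: cvg_iter_sgstep.
Qed.

(** For fixed y and n large, y / (n+1) lies in ]-pi, pi[, where the sine has the sign of its
    argument. So the unbounded [f - c] is reached through the bounded functions sin ((f - c) /
    (n+1)). *)
Let trig_mult_sgB f c : S f -> trig_mult (fun x => Num.sg (f x - c)).
Proof.
move=> Sf.
have mn n : trig_mult (fun x => Num.sg (sin (n.+1%:R^-1 * (f x - c)))).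
  apply: trig_mult_sg => [x|]; first exact: sin_max.
  have := trig_mult_sin (- n.+1%:R^-1 * c) (subspaceZ n.+1%:R^-1 linS Sf).
  by congr trig_mult; apply/funext => x; rewrite !fctE /GRing.scale /=; congr sin; ring.
apply: (trig_mult_cvg _ mn); split.
- by move=> n; exact: (mn n).1.1.
- exists 1 => n x.
  by have [->|y0] := eqVneq (sin (n.+1%:R^-1 * (f x - c))) 0;
    rewrite ?sgr0 ?normr0// normr_sg y0.
- move=> x; set y := f x - c; apply: cvg_near_cst; near=> n.
  have n0 : 0 < n.+1%:R^-1 :> R by rewrite invr_gt0.
  have yn : n.+1%:R^-1 * `|y| < pi.
    rewrite mulrC ltr_pdivrMr// -ltr_pdivrMl ?pi_gt0//.
    by rewrite (@lt_le_trans _ _ n%:R)//; [near: n; exact: nbhs_infty_gtr|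
      rewrite ler_nat].
  have [y0|y0|y0] := ltgtP 0 y; last by rewrite -y0 mulr0 sin0.
  - rewrite (gtr0_sg y0) gtr0_sg//; apply: sin_gt0_pi.
    by rewrite mulr_gt0//= -(gtr0_norm y0).
  - rewrite (ltr0_sg y0) ltr0_sg// -oppr_gt0 -sinN -mulrN; apply: sin_gt0_pi.
    by rewrite mulr_gt0 ?oppr_gt0//= -(ltr0_norm y0).
Unshelve. all: by end_near. Qed.

Let trig_mult_indic_gt f c : S f -> trig_mult (\1_(f @^-1` `]c, +oo[)).
Proof.
move=> Sf; have ms := trig_mult_sgB c Sf.
(* With s the sign of [f x - c], the indicator of s > 0 is (s^2 + s) / 2. *)
have := trig_multL (2^-1) (trig_multM ms ms) (trig_multL (2^-1 - 1) ms ms).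
congr trig_mult; apply/funext => x; rewrite !fctE /GRing.scale /= indicE.
rewrite (_ : (x \in _) = (0 < f x - c)); last first.
  by rewrite subr_gt0; apply/idP/idP => [/set_mem|cf]; [|apply/mem_set];
    rewrite /= in_itv/= andbT.
by case: sgrP => fc /=; field.
Qed.

Let trig_mult_sigma_algebra :
  sigma_algebra setT [set A | trig_mult (\1_A : T -> R)].
Proof.
have mC A : trig_mult (\1_A : T -> R) -> trig_mult (\1_(~` A) : T -> R).
  move=> mA; have := trig_multL (-1) mA trig_mult1; congr trig_mult.
  apply/funext => x; rewrite !fctE /GRing.scale /= !indicE in_setC.
  by case: (x \in A) => /=; ring.
have m0 : trig_mult (\1_set0 : T -> R).
  have := trig_multL (-1) trig_mult1 trig_mult1; congr trig_mult.
  by rewrite indic0; apply/funext => x; rewrite !fctE /GRing.scale /=; ring.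
split => [//|A mA|F mF]; first by rewrite setTD; exact: mC.
have mU n : trig_mult (\1_(\big[setU/set0]_(i < n) F i) : T -> R).
  elim: n => [|n IH]; first by rewrite big_ord0.
  rewrite big_ord_recr/= -[X in \1_X]setCK setCU; apply: (mC).
  have := trig_multM (mC _ IH) (mC _ (mF n)); congr trig_mult.
  by apply/funext => x; rewrite /= !indicE in_setI -mulnb natrM.
apply: (trig_mult_cvg _ mU); split.
- by move=> n; exact: (mU n).1.1.
- by exists 1 => n x; rewrite indicE; case: (_ \in _); rewrite ?normr1 ?normr0.
- move=> x; rewrite indicE; have [|] := boolP (x \in \bigcup_k F k).
    move=> /set_mem[k _ Fkx]; apply: cvg_near_cst; exists k.+1 => // n /= kn.
    rewrite indicE mem_set// -bigcup_mkord; exists k => //.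
  move=> /negP xF; apply: cvg_near_cst; apply: nearW => n.
  rewrite indicE memNset// -bigcup_mkord => -[k _ Fkx]; apply: xF.
  by apply/mem_set; exists k.
Qed.

(** The half-lines generate the Borel sets, so all indicators of events of [S] are multipliers. By
    [Phi0] the constant 1 is a function to which they may be applied; the phase pi/2 with the zero
    function of [S] then removes the sine. *)
Lemma trig_uniqueness A : sigma_family S id A -> Phi \1_A = 0.
Proof.
have sub : sigma_family S id `<=` [set A | trig_mult (\1_A : T -> R)].
  apply: smallest_sub; first exact: trig_mult_sigma_algebra.
  move=> _ [f Sf [B mB <-]] /=; rewrite setTI.
  have : <<s @RGenOInfty.G R >> B.
    have := mB.
    by rewrite -[measurable B]/(_.-sigma.-measurable B) RGenOInfty.measurableE.
  move: B {mB}; apply: smallest_sub; last first.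
    by move=> _ [c ->] /=; exact: trig_mult_indic_gt.
  have [m0 mD mU] := trig_mult_sigma_algebra.
  split => [|B|F mF] /=; first by rewrite preimage_set0.
    by rewrite setTD preimage_setC -setTD; exact: mD.
  by rewrite preimage_bigcup; exact: mU.
move=> /sub[bA mA].
have [] := mA (cst 1).
  split; first exact: bmf_cst.
  move=> f th Sf; rewrite -[RHS](Phi0 th Sf); congr Phi.
  by apply/funext => x /=; rewrite mul1r.
move=> _ /(_ _ (pi / 2) linS.1) <-; congr Phi; apply/funext => x /=.
by rewrite [X in _ + X](_ : _ = 0)// addr0 sin_pihalf mulr1 mul1r.
Qed.

End trig_uniqueness.

(** * Gaussian laws *)

Section normal_integral.
Context (R : realType) (m s : R).
Notation mu := (@lebesgue_measure R).
Notation pdf := (normal_pdf m s).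

Lemma normal_probE (A : set R) : measurable A ->
  normal_prob m s A = (\int[mu]_x (\1_A x * pdf x))%:E.
Proof.
move=> mA; rewrite /normal_prob /Rintegral fineK; last first.
  apply: integrable_fin_num => //.
  exact: (@bmf_integrableM _ _ _ mu _ pdf (bmf_indic R mA)
    (integrable_normal_pdf m s)).
rewrite [LHS]integral_mkcond; congr (integral _ _ _).
apply/funext => x; rewrite patchE indicE; case: ifPn => _ /=; by rewrite ?mul1r ?mul0r.
Qed.

Lemma Rintegral_normal_prob (f : R -> R) : bmf f ->
  \int[normal_prob m s]_x f x = \int[mu]_x (f x * pdf x).
Proof.
move=> bf; apply/eqP; rewrite -subr_eq0; apply/eqP.
have b1 := Rintegral_bounded_functional1 (normal_prob m s).
have b2 := @Rintegral_bounded_functional _ _ _ mu pdf (integrable_normal_pdf m s).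
apply: (bounded_functional_indic (bounded_functionalB b1 b2) bf) => B mB.
have mfB : measurable (f @^-1` B).
  by rewrite -[X in measurable X]setTI; exact: bf.1.
apply/eqP; rewrite subr_eq0; apply/eqP.
apply: EFin_inj; rewrite -normal_probE// /Rintegral integral_indic// setIT.
by rewrite fineK// fin_num_measure.
Qed.

End normal_integral.

Section integral_of_derivative.
Context (R : realType).
Notation mu := (@lebesgue_measure R).

(** Integration by parts on the whole line. As [f] is integrable, its integral is the limit over the
    intervals [-n, n], so the boundary terms need to be controlled along integers only. *)
Lemma Rintegral_derive_eq0 (F f : R -> R) :
  (forall x : R, is_derive x (1 : R) F (f x)) -> continuous f ->
  mu.-integrable setT (EFin \o f) ->
  F n%:R - F (- n%:R) @[n --> \oo] --> (0 : R) ->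
  \int[mu]_x f x = 0.
Proof.
move=> dF cf fi F0.
have mf : measurable_fun setT f by exact: continuous_measurable_fun.
pose f_ n := f \_ `[- n%:R, n%:R].
have [] := @dominated_convergence _ _ _ mu setT measurableT
  (fun n x => (f_ n x)%:E) (EFin \o f) (abse \o (EFin \o f)).
- move=> n; apply/measurable_EFinP; apply: (measurable_restrictT _ _).1.
    exact: measurable_itv.
  exact: measurable_funTS.
- exact/measurable_EFinP.
- apply: aeW => x _; apply: cvg_near_cst; near=> n.
  rewrite /f_ patchE mem_set//= in_itv/= -ler_norml.
  by near: n; exact: nbhs_infty_ger.
- exact: integrable_abse.
- apply: aeW => x n _; rewrite /f_ patchE; case: ifPn => _ //=.
  by rewrite normr0 lee_fin.
move=> _ _ /= fcvg.
suff : (F n%:R - F (- n%:R))%:E @[n --> \oo] --> (\int[mu]_x (EFin \o f) x)%E.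
  move=> /(cvg_unique _) /(_ (cvg_EFin (nearW _ _) F0)) h.
  by rewrite /Rintegral h.
apply: cvg_trans fcvg; apply: near_eq_cvg; near=> n.
have n0 : 0 < n%:R :> R by near: n; exact: nbhs_infty_gtr.
have nn : - n%:R < n%:R :> R by lra.
have cF x : {for x, continuous F}.
  by apply/differentiable_continuous/derivable1_diffP; have [] := dF x.
rewrite EFinB -(@continuous_FTC2 _ f F _ _ nn).
- rewrite [RHS]integral_mkcond; apply: eq_integral => x _.
  by rewrite restrict_EFin.
- exact: continuous_subspaceT.
- split.
  + by move=> x _; have [] := dF x.
  + exact/cvg_at_right_filter/cF.
  + exact/cvg_at_left_filter/cF.
- by move=> x _; rewrite derive1E; have [_] := dF x.
Unshelve. all: by end_near. Qed.

End integral_of_derivative.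

(** * Characteristic function of the normal law *)

Section normal_charfun.
Context (R : realType) (m s : R).
Hypothesis s0 : s != 0.
Notation mu := (@lebesgue_measure R).
Notation g := (normal_pdf m s).

(** Doubling the standard deviation absorbs the linear factor. In terms of y the two exponentials
    are exp(-4y) and exp(-y), while |x - m| / |s| is the square root of 8y, which is at most 1 + 2y
    and so at most exp(2y). *)
Let le_center_normal_fun (x : R) :
  `|x - m| * normal_fun m s x <= `|s| * normal_fun m (2 * s) x.
Proof.
pose y := (x - m) ^+ 2 / (8 * s ^+ 2).
have ss : 0 < `|s| by rewrite normr_gt0.
have y0 : 0 <= y by rewrite divr_ge0 ?sqr_ge0// mulr_ge0 ?sqr_ge0.
rewrite (_ : normal_fun m s x = expR (2 * y) * expR (- (6 * y))); last first.
  by rewrite /normal_fun -expRD; congr expR; rewrite /y; field.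
rewrite (_ : normal_fun m (2 * s) x = expR (- y)); last first.
  by rewrite /normal_fun; congr expR; rewrite /y; field.
have h : `|x - m| <= `|s| * (1 + 2 * y).
  have -> : y = (`|x - m| / `|s|) ^+ 2 / 8.
    by rewrite exprMn exprVn !real_normK ?num_real// /y; field.
  rewrite mulrC -ler_pdivrMr//; set w := _ / _.
  have := sqr_ge0 (1 - w / 2); lra.
have h' : `|x - m| <= `|s| * expR (2 * y).
  by rewrite (le_trans h)// ler_wpM2l// expR_ge1Dx.
have e1 : expR (2 * y) * (expR (2 * y) * expR (- (6 * y))) <= expR (- y).
  by rewrite -!expRD ler_expR; lra.
by rewrite (le_trans (ler_wpM2r _ h'))// -?mulrA ?ler_wpM2l// mulr_ge0 ?expR_ge0.
Qed.

Lemma integrable_center_normal_pdf :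
  mu.-integrable setT (EFin \o (fun x => (x - m) * g x)).
Proof.
have s20 : 2 * s != 0 by rewrite mulf_neq0.
have mg := measurable_normal_pdf m s.
pose K := normal_peak s * `|s| / normal_peak (2 * s).
apply: (@le_integrable _ _ _ mu _ measurableT _
  (fun x => K%:E * (EFin \o normal_pdf m (2 * s)) x)%E).
- apply/measurable_EFinP; apply: measurable_funM => //.
  exact: measurable_funB.
- move=> x _; rewrite lee_fin.
  rewrite !normal_pdfE// [X in X * normal_fun m (2 * s) x]/=.
  rewrite normrM (ger0_norm (mulr_ge0 (normal_peak_ge0 _) (normal_fun_ge0 _ _ _))).
  rewrite mulrCA (le_trans _ (ler_norm _))//.
  rewrite [K * _]mulrA /K divfK ?gt_eqF ?normal_peak_gt0// -mulrA.
  by rewrite ler_wpM2l ?normal_peak_ge0 ?le_center_normal_fun.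
- by apply: integrableZl => //; exact: integrable_normal_pdf.
Qed.

Let der_g (x : R) : is_derive x 1 g (- ((x - m) / s ^+ 2) * g x).
Proof.
rewrite normal_pdfE//.
have h : is_derive x 1 (fun x => - (x - m) ^+ 2 / (s ^+ 2 *+ 2))
    (- ((x - m) / s ^+ 2)).
  apply: is_derive_eq; rewrite !scaler0 !add0r /GRing.scale /=; by field.
have h2 := @is_derive1_comp _ expR _ x _ _ (is_derive_expR _) h.
have h3 := is_deriveZ (normal_peak s) h2.
refine (is_derive_eq h3 _); rewrite /GRing.scale /= /normal_fun; ring.
Qed.

Let cvg_normal_pdf0 (c : R) : g (n%:R + c) @[n --> \oo] --> (0 : R).
Proof.
rewrite normal_pdfE// -[X in _ --> X](mulr0 (normal_peak s)).
apply: cvgM; first exact: cvg_cst.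
have -> : (fun n => normal_fun m s (n%:R + c)) =
    (fun y => expR (- y)) \o (fun z => z * (s ^+ 2 *+ 2)^-1) \o
    (fun x => x ^+ 2) \o (fun x => x + (c - m)) \o (fun n : nat => n%:R).
  by apply/funext => n; rewrite /normal_fun /= -addrA mulNr.
apply: cvg_comp; first exact: cvgr_idn.
apply: cvg_comp; first exact: cvg_addrr.
apply: cvg_comp; first exact: cvgr_expr2.
apply: cvg_comp; last exact: cvgr_expR.
apply: gt0_cvgMly; last exact: cvg_id.
by rewrite invr_gt0 pmulrn_lgt0// exprn_even_gt0.
Qed.

Let normal_pdfN x : g (- x) = g (x + 2 * m).
Proof.
rewrite normal_pdfE//= /normal_fun (_ : - x - m = - (x + 2 * m - m)); last by ring.
by rewrite sqrrN.
Qed.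

Let sg (th l x : R) : R := sin (th + l * (x - m)) * g x.

Let sgDpi th l x : sg (th + pi) l x = - sg th l x.
Proof.
by rewrite /sg addrAC [sin _]sinDpi mulNr.
Qed.

Let der_sg th l (x : R) : is_derive x 1 (sg th l)
  (l * sg (th + pi / 2) l x - s ^- 2 * (sin (th + l * (x - m)) * ((x - m) * g x))).
Proof.
have h : is_derive x 1 (fun x => th + l * (x - m)) l.
  by apply: is_derive_eq; rewrite /GRing.scale /=; ring.
have h2 := @is_derive1_comp _ (@sin R) _ x _ _ (is_derive_sin _) h.
have h3 := is_deriveM h2 (der_g x); refine (is_derive_eq h3 _).
rewrite /GRing.scale /= /sg.
rewrite (_ : th + pi / 2 + _ = th + l * (x - m) + pi / 2); last by ring.
by rewrite sinDpihalf; set a := sin _; set b := cos _; field.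
Qed.

Let bmf_trig th l : bmf (fun x : R => sin (th + l * (x - m))).
Proof.
apply: bmf_sin; apply: measurable_funD => //; apply: measurable_funM => //.
exact: measurable_funB.
Qed.

Let sg_integrable th l : mu.-integrable setT (EFin \o sg th l).
Proof.
exact: (@bmf_integrableM _ _ _ mu _ g (bmf_trig th l) (integrable_normal_pdf m s)).
Qed.

Let xsg_integrable th l : mu.-integrable setT
  (EFin \o (fun x => sin (th + l * (x - m)) * ((x - m) * g x))).
Proof.
exact: (@bmf_integrableM _ _ _ mu _ (fun x => (x - m) * g x) (bmf_trig th l)
  integrable_center_normal_pdf).
Qed.

Let trig_continuous th l : continuous (fun x : R => sin (th + l * (x - m))).
Proof.
move=> x; apply/differentiable_continuous/derivable1_diffP.
have h : is_derive x 1 (fun x => th + l * (x - m)) l.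
  by apply: is_derive_eq; rewrite /GRing.scale /=; ring.
by have [] := @is_derive1_comp _ (@sin R) _ x _ _ (is_derive_sin _) h.
Qed.

(** Stein's identity for the sine: the derivative of [sg th l] integrates to zero. *)
Let Rintegral_xsg th l :
  \int[mu]_x (sin (th + l * (x - m)) * ((x - m) * g x)) =
  s ^+ 2 * l * \int[mu]_x sg (th + pi / 2) l x.
Proof.
have i1 : mu.-integrable setT (EFin \o (fun x => l * sg (th + pi / 2) l x)).
  rewrite (_ : EFin \o _ = (fun x => l%:E * (EFin \o sg (th + pi / 2) l) x)%E)//.
  exact: integrableZl.
have i2 : mu.-integrable setT
    (EFin \o (fun x => s ^- 2 * (sin (th + l * (x - m)) * ((x - m) * g x)))).
  have := integrableZl measurableT (s ^- 2) (xsg_integrable th l).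
  by apply: eq_integrable => // x _; rewrite /= EFinM.
have E := Rintegral_derive_eq0 (der_sg th l).
have : l * (\int[mu]_x sg (th + pi / 2) l x) -
  s ^- 2 * (\int[mu]_x (sin (th + l * (x - m)) * ((x - m) * g x))) = 0.
  rewrite -(RintegralZl _ measurableT (sg_integrable _ _)).
  rewrite -(RintegralZl _ measurableT (xsg_integrable _ _)).
  rewrite -(RintegralB measurableT i1 i2).
  apply: E.
  - move=> x; apply: cvgB; apply: cvgM; try exact: cvg_cst.
    + apply: cvgM; first exact: trig_continuous.
      exact: continuous_normal_pdf.
    + apply: cvgM; first exact: trig_continuous.
      apply: cvgM; last exact: continuous_normal_pdf.
      by apply: cvgB; [exact: cvg_id|exact: cvg_cst].
  - have := integrableB measurableT i1 i2.
    by apply: eq_integrable => // x _; rewrite /= EFinB.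
  - have gg0 : g n%:R + g (n%:R + 2 * m) @[n --> \oo] --> (0 : R).
      rewrite -[X in _ --> X]addr0; apply: cvgD; last exact: cvg_normal_pdf0.
      by under eq_fun do rewrite -[_%:R]addr0; exact: cvg_normal_pdf0.
    apply: norm_cvg0.
    apply: (@squeeze_cvgr _ _ _ _ (cst 0) _ _ _ _ _ gg0); last exact: cvg_cst.
    apply: nearW => n; rewrite normr_ge0/= (le_trans (ler_normB _ _))//.
    rewrite /sg !normrM normal_pdfN !(ger0_norm (normal_pdf_ge0 _ _ _)).
    by apply: lerD; rewrite ler_piMl ?normal_pdf_ge0 ?sin_max.
move=> /eqP; rewrite subr_eq0 => /eqP h.
have -> : s ^+ 2 * l * \int[mu]_x sg (th + pi / 2) l x =
  s ^+ 2 * (l * \int[mu]_x sg (th + pi / 2) l x) by rewrite mulrA.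
by rewrite h mulrA mulfV ?mul1r// expf_neq0.
Qed.

(** Differentiation under the integral followed by Stein's identity gives the linear differential
    equation of the Gaussian characteristic function. Each of the two operations adds pi/2 to the
    phase, and the half turn yields the minus sign. *)
Let der_charfun (th l : R) : is_derive l (1 : R) (fun l => \int[mu]_x sg th l x)
  (- s ^+ 2 * l * \int[mu]_x sg th l x).
Proof.
have Il : `](l - 1), (l + 1)[%classic l by rewrite /= in_itv/=; lra.
have dl (y l' : R) : is_derive l' 1 (fun l => sg th l y)
    (sin (th + pi / 2 + l' * (y - m)) * ((y - m) * g y)).
  have h : is_derive l' 1 (fun l => th + l * (y - m)) (y - m).
    by apply: is_derive_eq; rewrite /GRing.scale /=; ring.
  have h2 := @is_derive1_comp _ (@sin R) _ l' _ _ (is_derive_sin _) h.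
  have h3 := is_deriveM h2 (is_derive_cst (g y) l' 1); refine (is_derive_eq h3 _).
  rewrite /GRing.scale /=.
  rewrite (_ : th + pi / 2 + _ = th + l' * (y - m) + pi / 2); last by ring.
  by rewrite sinDpihalf; ring.
have H1 : forall x, `](l - 1), (l + 1)[%classic x ->
  mu.-integrable setT (EFin \o sg th x) by move=> x _; exact: sg_integrable.
have H2 : forall x y, `](l - 1), (l + 1)[%classic x -> setT y ->
  derivable (fun l => sg th l y) x 1 by move=> x y _ _; have [] := dl y x.
have H3 : forall y, 0 <= `|(y - m) * g y| by [].
have H4 : mu.-integrable setT (EFin \o (fun y => `|(y - m) * g y|)).
  exact: integrable_norm integrable_center_normal_pdf.
have H5 : forall x y, `](l - 1), (l + 1)[%classic x -> setT y ->
    `|partial1of2 (sg th) x y| <= `|(y - m) * g y|.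
  move=> x y _ _; rewrite partial1of2E; have [_ ->] := dl y x.
  by rewrite normrM ler_piMl ?sin_max.
have D := derivable_under_integral measurableT Il H1 H2 H3 H4 H5.
apply: DeriveDef => //; rewrite -derive1E.
rewrite (differentiation_under_integral measurableT Il H1 H2 H3 H4 H5).
transitivity (\int[mu]_y (sin (th + pi / 2 + l * (y - m)) * ((y - m) * g y))).
  by apply: eq_Rintegral => y _; rewrite /= partial1of2E; have [_ ->] := dl y l.
rewrite Rintegral_xsg (_ : th + pi / 2 + pi / 2 = th + pi); last by field.
under eq_Rintegral do rewrite sgDpi -mulN1r.
by rewrite RintegralZl//; ring.
Qed.

(* The phase th makes a single real identity cover the real and imaginary parts
   of the characteristic function. *)
Lemma normal_charfun th l :
  \int[normal_prob m s]_x (sin (th + l * (x - m))) =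
  sin th * expR (- (l ^+ 2 * s ^+ 2 / 2)).
Proof.
rewrite (Rintegral_normal_prob m s (bmf_trig th l)).
(* [h] divides the integral by the expected Gaussian factor. By [der_charfun] its derivative
   vanishes, so its value at [l] can be read off at 0. *)
pose h l := expR (l ^+ 2 * s ^+ 2 / 2) * \int[mu]_x sg th l x.
have -> : sin th = h 0.
  rewrite /h expr0n/= !mul0r expR0 mul1r.
  under eq_Rintegral do rewrite /sg mul0r addr0.
  rewrite RintegralZl//; last exact: integrable_normal_pdf.
  by rewrite /Rintegral integral_normal_pdf mulr1.
have -> : h 0 = h l.
  apply: is_derive_0_is_cst => x.
  have d1 : is_derive x 1 (fun l => l ^+ 2 * s ^+ 2 / 2) (x * s ^+ 2).
    by apply: is_derive_eq; rewrite /GRing.scale /=; field.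
  have d2 := @is_derive1_comp _ expR _ x _ _ (is_derive_expR _) d1.
  have d3 := is_deriveM d2 (der_charfun th x); refine (is_derive_eq d3 _).
  by rewrite /GRing.scale /=; ring.
by rewrite /h mulrAC -expRD subrr expR0 mul1r.
Qed.

End normal_charfun.

Section gaussian_functional.
Context (R : realType).

Definition gaussian_functional (m s : R) (f : R -> R) : R :=
  if s == 0 then f m else \int[normal_prob m s]_x f x.

Lemma gaussian_functional_bounded m s :
  bounded_functional (gaussian_functional m s).
Proof.
rewrite /gaussian_functional; have [_|s0] := eqVneq s 0.
  by split => [c f g _ _|f_ f [_ _]]; [rewrite !fctE|exact].
exact: (Rintegral_bounded_functional1 (normal_prob m s)).
Qed.

Lemma gaussian_functional_indic m s (B : set R) : measurable B ->
  (gaussian_functional m s \1_B)%:E = gaussian_law m s B.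
Proof.
move=> mB; rewrite /gaussian_functional /gaussian_law.
have [_|s0] := eqVneq s 0; first by rewrite diracE indicE.
by rewrite /Rintegral integral_indic// setIT fineK// fin_num_measure.
Qed.

Lemma gaussian_charfun m s th l :
  gaussian_functional m s (fun x => sin (th + l * (x - m))) =
  sin th * expR (- (l ^+ 2 * s ^+ 2 / 2)).
Proof.
rewrite /gaussian_functional; have [->|s0] := eqVneq s 0.
  by rewrite subrr mulr0 addr0 expr0n/= mulr0 mul0r oppr0 expR0 mulr1.
exact: normal_charfun.
Qed.

End gaussian_functional.

Section centered_gaussian.
Context (R : realType) (d : measure_display) (T : measurableType d)
  (P : probability T R).

Lemma bounded_functional_comp (d' : measure_display) (E : measurableType d')
    (Z : T -> E) : measurable_fun setT Z ->
  bounded_functional (fun f : E -> R => \int[P]_w f (Z w)).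
Proof.
move=> mZ; have [lin cvgP] := Rintegral_bounded_functional1 P.
have bZ (f : E -> R) : bmf f -> bmf (f \o Z).
  move=> [mf [C fC]]; split; first exact: measurableT_comp.
  by exists C => x; exact: fC.
split => [c f g /bZ bf /bZ bg|f_ f [mf [C fC] ff]]; first exact: lin.
apply: (cvgP (fun n => f_ n \o Z) (f \o Z)); split.
- by move=> n; exact: measurableT_comp.
- by exists C => n x; exact: fC.
- by move=> x; exact: ff.
Qed.

Lemma Rintegral_indic (A : set T) : measurable A ->
  (\int[P]_w \1_A w)%:E = P A.
Proof.
by move=> mA; rewrite /Rintegral integral_indic// setIT fineK// fin_num_measure.
Qed.

Lemma Rintegral_prob_cst (c : R) : \int[P]_w c = c.
Proof. by rewrite Rintegral_cst// [X in fine X](probability_setT P) mulr1. Qed.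

Lemma Rintegral_gaussian_law (Z : T -> R) m s (f : R -> R) :
  measurable_fun setT Z ->
  (forall B : set R, measurable B -> pushforward P Z B = gaussian_law m s B) ->
  bmf f -> \int[P]_w f (Z w) = gaussian_functional m s f.
Proof.
move=> mZ lawZ bf; apply/eqP; rewrite -subr_eq0; apply/eqP.
apply: (bounded_functional_indic (bounded_functionalB
  (bounded_functional_comp mZ) (gaussian_functional_bounded m s)) bf) => B mB.
have mfB : measurable (f @^-1` B).
  by rewrite -[X in measurable X]setTI; exact: bf.1.
apply/eqP; rewrite subr_eq0; apply/eqP/EFin_inj.
rewrite gaussian_functional_indic// -lawZ// /pushforward -Rintegral_indic//.
by rewrite -[X in measurable X]setTI; exact: mZ.
Qed.

(** The linear functions on the line generate the Borel sets, so [trig_uniqueness] applied to the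
    difference of the two laws identifies them. *)
Lemma gaussian_law_charfun (Z : T -> R) m s : measurable_fun setT Z ->
  (forall th l, \int[P]_w sin (th + l * (Z w - m)) =
     sin th * expR (- (l ^+ 2 * s ^+ 2 / 2))) ->
  forall B : set R, measurable B -> pushforward P Z B = gaussian_law m s B.
Proof.
move=> mZ Zchar B mB.
pose S : set (R -> R) := [set f | exists c, f = (fun x => c * x)].
have linS : linear_subspace S.
  split; first by exists 0; apply/funext => x; rewrite mul0r.
  move=> c _ _ [a ->] [b ->]; exists (c * a + b); apply/funext => x.
  by rewrite !fctE /GRing.scale /= mulrDl mulrA.
have mS f : S f -> measurable_fun setT f.
  by move=> [c ->]; exact: measurable_funM.
have bPhi := bounded_functionalB
  (bounded_functional_comp mZ) (gaussian_functional_bounded m s).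
have := @trig_uniqueness _ _ _ _ _ bPhi linS mS _ B.
rewrite -gaussian_functional_indic//.
have -> : pushforward P Z B = (\int[P]_w \1_B (Z w))%:E.
  rewrite /pushforward -Rintegral_indic//.
  by rewrite -[X in measurable X]setTI; exact: mZ.
move=> trig; congr EFin; apply/eqP; rewrite -subr_eq0; apply/eqP/trig.
  move=> _ th [l ->].
  have e x : th + l * x = (th + l * m) + l * (x - m) by ring.
  under eq_Rintegral do rewrite e.
  rewrite (_ : (fun x => sin (th + l * x)) =
    (fun x => sin (th + l * m + l * (x - m)))); last first.
    by apply/funext => x; rewrite e.
  by rewrite Zchar gaussian_charfun subrr.
apply: sub_sigma_algebra; exists id; last first.
  by exists B => //; rewrite setTI.
by exists 1; apply/funext => x; rewrite mul1r.
Qed.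

(** Centred Gaussian variables, described by characteristic function with the second moment as
    variance. A variance equal to zero needs no separate case in this form. *)
Definition cgauss (Z : T -> R) : Prop :=
  [/\ measurable_fun setT Z, P.-integrable setT (EFin \o (fun w => Z w ^+ 2)) &
      forall th l, \int[P]_w sin (th + l * Z w) =
        sin th * expR (- (l ^+ 2 * (\int[P]_w (Z w ^+ 2)) / 2))].

Lemma sqr_Rintegral_ge0 (Z : T -> R) : 0 <= \int[P]_w (Z w ^+ 2).
Proof. by apply: Rintegral_ge0 => w _; exact: sqr_ge0. Qed.

Lemma cgauss_law Z : cgauss Z -> forall B : set R, measurable B ->
  pushforward P Z B = gaussian_law 0 (Num.sqrt (\int[P]_w (Z w ^+ 2))) B.
Proof.
move=> [mZ _ Zchar]; apply: gaussian_law_charfun => // th l.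
under eq_Rintegral do rewrite subr0.
by rewrite Zchar sqr_sqrtr// sqr_Rintegral_ge0.
Qed.

Lemma cgauss_gaussian_rv Z : cgauss Z -> gaussian_rv P Z.
Proof.
move=> gZ; split; first by case: gZ.
by do 2 eexists; exact: cgauss_law gZ.
Qed.

End centered_gaussian.

Section derivative_along_sequence.
Context (R : realType).

Lemma cvg_diff_quotient0 (f : R -> R) (D y : R) (h : nat -> R) :
  is_derive (0 : R) (1 : R) f D -> f 0 = 0 -> h n @[n --> \oo] --> (0 : R) ->
  (forall n, h n != 0) -> f (y * h n) / h n @[n --> \oo] --> y * D.
Proof.
move=> [df <-] f0 h0 hn0; have [->|y0] := eqVneq y 0.
  by under eq_fun do rewrite mul0r f0 mul0r; rewrite mul0r; exact: cvg_cst.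
have /cvgr_dnbhsP/(_ (fun n => y * h n)) := df.
rewrite -[lim _]/('D_1 f 0) => H.
have {}H : (y * h n)^-1 * f (y * h n) @[n --> \oo] --> 'D_1 f 0.
  have : (fun n => (y * h n)^-1 *: ((f \o shift 0) ((y * h n) *: 1) - f 0))
      @ \oo --> 'D_1 f 0.
    apply: H; split; first by move=> n; rewrite mulf_neq0.
    by rewrite -[X in _ --> X](mulr0 y); apply: cvgM => //; exact: cvg_cst.
  by under eq_fun do rewrite /= addr0 f0 subr0 /GRing.scale /= mulr1.
have -> : (fun n => f (y * h n) / h n) =
    (fun n => y * ((y * h n)^-1 * f (y * h n))).
  by apply/funext => n; field; rewrite hn0 y0.
by apply: cvgM => //; exact: cvg_cst.
Qed.

Lemma norm_sin_le (x : R) : `|sin x| <= `|x|.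
Proof.
wlog x0 : x / 0 < x => [hw|].
  have [x0|x0|<-] := ltgtP 0 x; [exact: hw| |by rewrite sin0 normr0].
  by rewrite -normrN -sinN -[leRHS]normrN hw// oppr_gt0.
have [c _] := @MVT _ sin cos 0 x x0 (fun z _ => is_derive_sin z)
  (continuous_subspaceT (@continuous_sin R)).
rewrite sin0 !subr0 => ->; rewrite normrM ler_piMl//; exact: cos_max.
Qed.

End derivative_along_sequence.

(** * Moments and pointwise limits of centred Gaussian variables *)

Section gaussian_moments.
Context (R : realType) (d : measure_display) (T : measurableType d)
  (P : probability T R).
Implicit Types (Z : T -> R) (v : R).

Let h (n : nat) : R := n.+1%:R^-1.

Let h_gt0 n : 0 < h n. Proof. by rewrite invr_gt0. Qed.

Let h_neq0 n : h n != 0. Proof. by rewrite gt_eqF. Qed.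

Let h_cvg0 : h n @[n --> \oo] --> (0 : R).
Proof.
by rewrite /h gtr0_cvgV0; [rewrite cvg_shiftS; exact: cvgr_idn|exact: nearW].
Qed.

Let sin_sqr_cvg (y : R) : (2 * sin (y / 2 * h n) / h n) ^+ 2 @[n --> \oo] --> y ^+ 2.
Proof.
have := cvg_diff_quotient0 (y := y / 2) (is_derive_sin 0) (@sin0 R) h_cvg0 h_neq0.
rewrite cos0 mulr1 => H.
have {}H : 2 * sin (y / 2 * h n) / h n @[n --> \oo] --> y.
  rewrite [X in _ --> X](_ : y = 2 * (y / 2)); last by field.
  by under eq_fun do rewrite -mulrA; apply: cvgM => //; exact: cvg_cst.
by under eq_fun do rewrite expr2; rewrite expr2; exact: cvgM.
Qed.

Let sin_sqr_le (y : R) n : (2 * sin (y / 2 * h n) / h n) ^+ 2 <= y ^+ 2.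
Proof.
rewrite -[leLHS]real_normK ?num_real// -[leRHS]real_normK ?num_real//.
rewrite lerXn2r ?nnegrE// !normrM normfV (gtr0_norm (h_gt0 n)) ler_pdivrMr//.
rewrite (le_trans (ler_wpM2l _ (norm_sin_le _)))//.
by rewrite !normrM (gtr0_norm (h_gt0 n)) normfV !normr_nat; lra.
Qed.

(* The second moment is the limit of the integrals of 2 (1 - cos (h Z)) / h^2,
   which dominates it by Fatou's lemma. *)
Lemma cgauss_of_charfun Z v : measurable_fun setT Z ->
  (forall th l, \int[P]_w sin (th + l * Z w) =
     sin th * expR (- (l ^+ 2 * v / 2))) ->
  cgauss P Z /\ \int[P]_w (Z w ^+ 2) = v.
Proof.
move=> mZ Zchar; pose f n w := (2 * sin (Z w / 2 * h n) / h n) ^+ 2.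
have mf n : measurable_fun setT (f n).
  apply: measurable_funX; apply: measurable_funM => //.
  apply: measurable_funM => //; apply: measurable_sin.
  by do 2 apply: measurable_funM => //.
have If n : \int[P]_w f n w = 2 * (1 - expR (- v / 2 * h n ^+ 2)) / h n ^+ 2.
  (* Half-angle formula: 4 sin(hZ/2)^2 = 2 (1 - cos(hZ)), and the cosine is the sine with phase
     pi/2, whose integral [Zchar] provides. *)
  transitivity (\int[P]_w ((2 / h n ^+ 2) * (1 - sin (pi / 2 + h n * Z w)))).
    apply: eq_Rintegral => w _; rewrite /f exprMn exprVn.
    rewrite (_ : pi / 2 + h n * Z w = (Z w / 2 * h n) *+ 2 + pi / 2); last by field.
    by rewrite sinDpihalf cos_mulr2n cos2sin2 mulr2n; field.
  have bs : bmf (fun w => sin (pi / 2 + h n * Z w)).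
    apply: bmf_sin; apply: measurable_funD => //.
    exact: measurable_funM.
  have b1 : bmf (cst 1 : T -> R) by exact: bmf_cst.
  have bB : bmf (fun w => 1 - sin (pi / 2 + h n * Z w)).
    by have := bmfD b1 (bmfZ (-1) bs); congr bmf; apply/funext => w;
      rewrite !fctE /GRing.scale /= mulN1r.
  rewrite RintegralZl//; last exact: bmf_integrable.
  rewrite RintegralB//; [|exact: bmf_integrable|exact: bmf_integrable].
  rewrite Zchar sin_pihalf mul1r Rintegral_prob_cst.
  rewrite (_ : - (h n ^+ 2 * v / 2) = - v / 2 * h n ^+ 2); last by field.
  by field.
have If_cvg : \int[P]_w f n w @[n --> \oo] --> v.
  under eq_fun do rewrite If.
  (* The integral of [f n] is the difference quotient of this function at 0, with argument (-v/2)
     h^2 and step h^2. Its limit is (-v/2)(-2) = v. *)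
  have d1 : is_derive (0 : R) (1 : R) (fun x => 2 * (1 - expR x)) (- 2).
    apply: is_derive_eq; rewrite /GRing.scale /= expR0; ring.
  have := @cvg_diff_quotient0 _ _ _ (- v / 2) (fun n => h n ^+ 2) d1.
  rewrite (_ : - v / 2 * - 2 = v); last by field.
  apply; first by rewrite expR0 subrr mulr0.
    rewrite -[X in _ --> X](mul0r (0 : R)); under eq_fun do rewrite expr2.
    exact: cvgM.
  by move=> n; rewrite expf_neq0.
have iZ : P.-integrable setT (EFin \o (fun w => Z w ^+ 2)).
  apply/integrableP; split.
    by apply/measurable_EFinP; exact: measurable_funX.
  under eq_integral do rewrite /= ger0_norm ?sqr_ge0//.
  have mEf n : measurable_fun setT (fun w => (f n w)%:E).
    exact/measurable_EFinP.
  have f_ge0 n w : setT w -> (0 <= (f n w)%:E)%E by rewrite lee_fin sqr_ge0.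
  have := fatou P measurableT mEf f_ge0.
  have -> : (fun w => limn_einf (fun n => (f n w)%:E)) = (fun w => (Z w ^+ 2)%:E).
    apply/funext => w; apply: (cvg_limn_einf_sup _).1.
    by apply: cvg_EFin; [exact: nearW|exact: sin_sqr_cvg].
  have -> : limn_einf (fun n => \int[P]_w (f n w)%:E)%E = v%:E.
    apply: (cvg_limn_einf_sup _).1.
    apply: cvg_EFin; last exact: If_cvg.
    apply: nearW => n.
    apply: integrable_fin_num => //; apply: bmf_integrable.
    split => //; exists ((2 / h n) ^+ 2) => w.
    rewrite ger0_norm ?sqr_ge0// /f mulrAC exprMn ler_piMr ?sqr_ge0//.
  by move=> /le_lt_trans; apply; exact: ltry.
have vE : \int[P]_w (Z w ^+ 2) = v.
  apply/esym; apply: (cvg_unique _ If_cvg) => //.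
  apply: fine_cvg; rewrite fineK; last exact: integrable_fin_num.
  have [] := @dominated_convergence _ _ _ P setT measurableT
    (fun n w => (f n w)%:E) (fun w => (Z w ^+ 2)%:E) (fun w => (Z w ^+ 2)%:E) => //.
  - by move=> n; apply/measurable_EFinP.
  - by apply/measurable_EFinP; exact: measurable_funX.
  - apply: aeW => w _.
    by apply: cvg_EFin; [exact: nearW|exact: sin_sqr_cvg].
  - by apply: aeW => w n _; rewrite /= lee_fin ger0_norm ?sqr_ge0// sin_sqr_le.
by split=> //; split => // th l; rewrite vE.
Qed.

Lemma cgauss_integrable Z : cgauss P Z -> P.-integrable setT (EFin \o Z).
Proof.
move=> [mZ iZ _]; apply: (@le_integrable _ _ _ P _ measurableT _
  (fun w => (1%:E + (Z w ^+ 2)%:E)%E)).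
- exact/measurable_EFinP.
- move=> w _ /=; rewrite lee_fin [leRHS]ger0_norm ?addr_ge0 ?sqr_ge0//.
  rewrite -[Z w ^+ 2]real_normK ?num_real//.
  have := sqr_ge0 (`|Z w| - 1); have := normr_ge0 (Z w); nra.
- apply: integrableD => //; exact: finite_measure_integrable_cst.
Qed.

(** At phase 0 the characteristic function says that sin(hZ) has mean zero. The quotients sin(hZ) /
    h tend to Z and are dominated by |Z|. *)
Lemma cgauss_mean0 Z : cgauss P Z -> \int[P]_w Z w = 0.
Proof.
move=> gZ; have [mZ iZ Zchar] := gZ.
pose f n w := sin (Z w * h n) / h n.
have mf n : measurable_fun setT (f n).
  by apply: measurable_funM => //; apply: measurable_sin; exact: measurable_funM.
have If n : \int[P]_w f n w = 0.
  rewrite RintegralZr//; last first.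
    by apply: bmf_integrable; apply: bmf_sin; exact: measurable_funM.
  under eq_Rintegral do rewrite -[_ * _]add0r mulrC.
  by rewrite Zchar sin0 mul0r mul0r.
have If0 : \int[P]_w f n w @[n --> \oo] --> (0 : R).
  by under eq_fun do rewrite If; exact: cvg_cst.
apply: (cvg_unique _ _ If0) => //.
apply: fine_cvg; rewrite fineK; last first.
  by apply: integrable_fin_num => //; exact: cgauss_integrable.
have [] := @dominated_convergence _ _ _ P setT measurableT
  (fun n w => (f n w)%:E) (EFin \o Z) (abse \o (EFin \o Z)) => //.
- by move=> n; apply/measurable_EFinP.
- exact/measurable_EFinP.
- apply: aeW => w _; apply: cvg_EFin; first exact: nearW.
  have := cvg_diff_quotient0 (y := Z w) (is_derive_sin 0) (@sin0 R) h_cvg0 h_neq0.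
  by rewrite cos0 mulr1.
- by apply: integrable_abse; exact: cgauss_integrable.
- apply: aeW => w n _; rewrite /= lee_fin normrM normfV (gtr0_norm (h_gt0 n)).
  rewrite ler_pdivrMr// (le_trans (norm_sin_le _))// normrM.
  by rewrite (gtr0_norm (h_gt0 n)).
Qed.

(** The law only provides some centre m. That [Z - m] is centred Gaussian yields the integrability
    of [Z], after which the vanishing expectation forces m = 0. *)
Lemma gaussian_rv_cgauss Z : gaussian_rv P Z -> ('E_P[Z] = 0)%E -> cgauss P Z.
Proof.
move=> [mZ [m [s lawZ]]] EZ.
have mZm : measurable_fun setT (fun w => Z w - m) by exact: measurable_funB.
have [|gZm _] := @cgauss_of_charfun (fun w => Z w - m) (s ^+ 2) mZm.
  move=> th l; rewrite -(gaussian_charfun m).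
  apply: (Rintegral_gaussian_law mZ lawZ (f := fun x => sin (th + l * (x - m)))).
  apply: bmf_sin; apply: measurable_funD => //; apply: measurable_funM => //.
  exact: measurable_funB.
have iZm := cgauss_integrable gZm.
have icm : P.-integrable setT (EFin \o cst m).
  exact: finite_measure_integrable_cst.
have iZ : P.-integrable setT (EFin \o Z).
  have := integrableD measurableT iZm icm.
  by apply: eq_integrable => // w _; rewrite /= -EFinD subrK.
have m0 : m = 0.
  have := cgauss_mean0 gZm; rewrite RintegralB//.
  rewrite Rintegral_prob_cst.
  move: EZ; rewrite unlock => EZ; rewrite /Rintegral EZ /= sub0r.
  by move=> /eqP; rewrite oppr_eq0 => /eqP.
by move: gZm; rewrite m0; congr cgauss; apply/funext => w; rewrite subr0.
Qed.

(** Convergence of the characteristic functions forces that of the variances: where the limit of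
    exp(-l^2 v_n / 2) is positive for some nonzero l, taking logarithms gives the limit of v_n. *)
Lemma cgauss_cvg (Z_ : nat -> T -> R) Z : (forall n, cgauss P (Z_ n)) ->
  (forall w, Z_ n w @[n --> \oo] --> Z w) ->
  cgauss P Z /\ \int[P]_w (Z_ n w ^+ 2) @[n --> \oo] --> \int[P]_w (Z w ^+ 2).
Proof.
move=> gZ_ ZZ; have mZ_ n : measurable_fun setT (Z_ n) by have [] := gZ_ n.
have mZ : measurable_fun setT Z.
  by apply: (measurable_fun_cvg mZ_) => w _; exact: ZZ.
have [_ cP] := Rintegral_bounded_functional1 P.
pose v n := \int[P]_w (Z_ n w ^+ 2).
have char_cvg th l : sin th * expR (- (l ^+ 2 * v n / 2)) @[n --> \oo] -->
    \int[P]_w sin (th + l * Z w).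
  have gE n : \int[P]_w sin (th + l * Z_ n w) = sin th * expR (- (l ^+ 2 * v n / 2)).
    by have [_ _ ->] := gZ_ n.
  under eq_fun do rewrite -gE.
  apply: (cP (fun n w => sin (th + l * Z_ n w))); split.
  - move=> n; apply: measurable_sin; apply: measurable_funD => //.
    exact: measurable_funM.
  - by exists 1 => n w; exact: sin_max.
  - move=> w; apply: (cvg_comp _ (@sin R)); last exact: continuous_sin.
    by apply: cvgD; [exact: cvg_cst|apply: cvgM => //; exact: cvg_cst].
pose c l := \int[P]_w sin (pi / 2 + l * Z w).
have c_cvg l : expR (- (l ^+ 2 * v n / 2)) @[n --> \oo] --> c l.
  by have := char_cvg (pi / 2) l; rewrite sin_pihalf; under eq_fun do rewrite mul1r.
(* Such an l exists because [c] tends to 1 along the null sequence [h]. This excludes variances that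
   tend to infinity. *)
have [l l0 cl0] : exists2 l, l != 0 & 0 < c l.
  have : c (h n) @[n --> \oo] --> (1 : R).
    have -> : 1 = \int[P]_w (cst (1 : R)) w.
      by rewrite Rintegral_prob_cst.
    apply: (cP (fun n w => sin (pi / 2 + h n * Z w))); split.
    - move=> n; apply: measurable_sin; apply: measurable_funD => //.
      exact: measurable_funM.
    - by exists 1 => n w; exact: sin_max.
    - move=> w; rewrite (_ : cst 1 w = sin (pi / 2)); last exact/esym/sin_pihalf.
      have : pi / 2 + h n * Z w @[n --> \oo] --> pi / 2 + 0 * Z w.
        apply: cvgD; first exact: cvg_cst.
        by apply: cvgM => //; exact: cvg_cst.
      rewrite mul0r addr0 => H; apply: (cvg_comp _ (@sin R) H).
      exact: continuous_sin.
  move=> /cvgr_gt /(_ 0 ltr01)[n _ /(_ n (leqnn n)) cn].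
  by exists (h n).
have v_cvg : v n @[n --> \oo] --> - (2 / l ^+ 2) * ln (c l).
  have : ln (expR (- (l ^+ 2 * v n / 2))) @[n --> \oo] --> ln (c l).
    by apply: (cvg_comp _ (@ln R)); [exact: c_cvg|exact: continuous_ln].
  under eq_fun do rewrite expRK.
  move=> /(cvgM (cvg_cst (- (2 / l ^+ 2)))); apply: cvg_trans.
  by apply: near_eq_cvg; apply: nearW => n; rewrite /=; field.
set V := - _ * _ in v_cvg.
have [|gZ ->] := @cgauss_of_charfun Z V mZ; last by split.
move=> th t; apply/esym/(cvg_unique _ _ (char_cvg th t)) => //.
apply: cvgM; first exact: cvg_cst.
apply: (cvg_comp _ (@expR R)); last exact: continuous_expR.
apply: cvgN; apply: cvgM; last exact: cvg_cst.
by apply: cvgM => //; exact: cvg_cst.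
Qed.

End gaussian_moments.

(** * Gaussian spaces *)

Section gaussian_space.
Context (R : realType) (d : measure_display) (T : measurableType d)
  (P : probability T R).
Implicit Types (f g h : T -> R) (S : set (T -> R)).

Definition ip f g : R := \int[P]_w (f w * g w).

Definition gspace S : Prop := linear_subspace S /\ forall f, S f -> cgauss P f.

Lemma ipC f g : ip f g = ip g f.
Proof. by apply: eq_Rintegral => w _; rewrite mulrC. Qed.

Lemma ip_sqr f : ip f f = \int[P]_w (f w ^+ 2).
Proof. by apply: eq_Rintegral => w _; rewrite expr2. Qed.

Lemma ip_ge0 f : 0 <= ip f f.
Proof. by rewrite ip_sqr sqr_Rintegral_ge0. Qed.

(** Replaces an L2 closure. Limits at every outcome are enough for integrals along continuous paths,
    and they preserve measurability without completing the measure. *)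
Definition pointwise_closure S : set (T -> R) :=
  [set Z | exists2 u : nat -> T -> R, forall n, S (u n) &
    forall w, u n w @[n --> \oo] --> Z w].

Lemma sub_pointwise_closure S : S `<=` pointwise_closure S.
Proof. by move=> f Sf; exists (fun=> f) => // w; exact: cvg_cst. Qed.

Lemma pointwise_closure_subspace S : linear_subspace S ->
  linear_subspace (pointwise_closure S).
Proof.
move=> lS; split; first by apply: sub_pointwise_closure; exact: lS.1.
move=> c f g [u Su uf] [v Sv vg]; exists (fun n => c *: u n + v n).
  by move=> n; exact: lS.2.
move=> w; apply: cvgD; last exact: vg.
by apply: cvgM; [exact: cvg_cst|exact: uf].
Qed.

Lemma gspace_pointwise_closure S : gspace S -> gspace (pointwise_closure S).
Proof.
move=> [lS gS]; split; first exact: pointwise_closure_subspace.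
by move=> f [u Su uf]; apply: (cgauss_cvg (Z_ := u) _ uf).1 => n; exact: gS.
Qed.

Section inside_gaussian_space.
Variable S : set (T -> R).
Hypothesis gS : gspace S.

Let lS : linear_subspace S := gS.1.

Lemma gspace_measurable f : S f -> measurable_fun setT f.
Proof. by move=> /gS.2 []. Qed.

(** Polarization: the product is a quarter of the difference of the squares of f + g and f - g, both
    in [S]. *)
Lemma gspace_mul_integrable f g : S f -> S g ->
  P.-integrable setT (EFin \o (fun w => f w * g w)).
Proof.
move=> Sf Sg; have [_ i1 _] := gS.2 _ (subspaceD lS Sf Sg).
have [_ i2 _] := gS.2 _ (subspaceB lS Sf Sg).
have := integrableZl measurableT (4^-1) (integrableB measurableT i1 i2).
apply: eq_integrable => // w _; rewrite /= -EFinB -EFinM; congr EFin.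
by rewrite !fctE; field.
Qed.

Lemma ip_linear c f g h : S f -> S g -> S h ->
  ip (c *: f + g) h = c * ip f h + ip g h.
Proof.
move=> Sf Sg Sh; have i1 := gspace_mul_integrable Sf Sh.
have i2 := gspace_mul_integrable Sg Sh.
rewrite /ip -RintegralZl// -RintegralD//.
  by apply: eq_Rintegral => w _; rewrite !fctE /GRing.scale /=; ring.
have := integrableZl measurableT c i1.
by apply: eq_integrable => // w _; rewrite /= EFinM.
Qed.

Lemma ipDl f g h : S f -> S g -> S h -> ip (f + g) h = ip f h + ip g h.
Proof. by move=> Sf Sg Sh; rewrite -[f]scale1r ip_linear// mul1r scale1r. Qed.

Lemma ip0l h : ip 0 h = 0.
Proof.
by rewrite /ip; under eq_Rintegral do rewrite mul0r; exact: Rintegral_prob_cst.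
Qed.

Lemma ipZl c f h : S f -> S h -> ip (c *: f) h = c * ip f h.
Proof.
by move=> Sf Sh; rewrite -[_ *: _]addr0 ip_linear// ?ip0l ?addr0//; exact: lS.1.
Qed.

Lemma ipBl f g h : S f -> S g -> S h -> ip (f - g) h = ip f h - ip g h.
Proof.
move=> Sf Sg Sh; rewrite -scaleN1r ipDl ?ipZl ?mulN1r//; exact: subspaceZ.
Qed.

Lemma ipDr f g h : S f -> S g -> S h -> ip h (f + g) = ip h f + ip h g.
Proof. by move=> Sf Sg Sh; rewrite ipC ipDl// !(ipC h). Qed.

Lemma ipBr f g h : S f -> S g -> S h -> ip h (f - g) = ip h f - ip h g.
Proof. by move=> Sf Sg Sh; rewrite ipC ipBl// !(ipC h). Qed.

Lemma ipZr c f h : S f -> S h -> ip h (c *: f) = c * ip h f.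
Proof. by move=> Sf Sh; rewrite ipC ipZl// (ipC h). Qed.

Lemma ip_suml n (c : 'I_n -> R) (v : 'I_n -> T -> R) h :
  (forall i, S (v i)) -> S h ->
  ip (\sum_i c i *: v i) h = \sum_i c i * ip (v i) h.
Proof.
move=> Sv Sh; suff : S (\sum_i c i *: v i) /\
  ip (\sum_i c i *: v i) h = \sum_i c i * ip (v i) h by case.
elim/big_rec2 : _ => [|i y z _ [Sz <-]]; first by rewrite ip0l; split => //; exact: lS.1.
split; last exact: ip_linear.
exact: lS.2.
Qed.

Lemma ip_sqrD f g : S f -> S g ->
  ip (f + g) (f + g) = ip f f + ip g g + 2 * ip f g.
Proof.
move=> Sf Sg; have SD := subspaceD lS Sf Sg.
by rewrite ipDl// !ipDr// (ipC g f); ring.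
Qed.

Lemma ip_sqrB f g : S f -> S g ->
  ip (f - g) (f - g) = ip f f + ip g g - 2 * ip f g.
Proof.
move=> Sf Sg; have SB := subspaceB lS Sf Sg.
by rewrite ipBl// !ipBr// (ipC g f); ring.
Qed.

Lemma ip_eq0 f g : S f -> S g -> ip f f = 0 -> ip f g = 0.
Proof.
move=> Sf Sg f0; apply/eqP; apply: contraT => fg0.
(* For this t the square of t f + g would be -1. This is the degenerate case of the Cauchy-Schwarz
   inequality. *)
pose t := - (ip g g + 1) / (2 * ip f g).
have Stf : S (t *: f) by exact: subspaceZ.
have := ip_ge0 (t *: f + g); rewrite ip_sqrD// ipZl// ipZr// f0 !mulr0 add0r.
rewrite ipZl// (_ : 2 * _ = - (ip g g + 1)); last by rewrite /t; field.
by lra.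
Qed.

Lemma gspace_char f th : S f ->
  \int[P]_w sin (th + f w) = sin th * expR (- (ip f f / 2)).
Proof.
move=> /gS.2 [_ _ /(_ th 1)]; rewrite -ip_sqr expr1n mul1r => <-.
by apply: eq_Rintegral => w _; rewrite mul1r.
Qed.

Lemma gspace_bmf_sin f th : S f -> bmf (fun w => sin (th + f w)).
Proof.
move=> Sf; apply: bmf_sin; apply: measurable_funD => //.
exact: gspace_measurable.
Qed.

Lemma gspace_sin_sin f g th eta : S f -> S g ->
  \int[P]_w (sin (th + f w) * sin (eta + g w)) =
  (cos (th - eta) * expR (- (ip (f - g) (f - g) / 2)) -
   cos (th + eta) * expR (- (ip (f + g) (f + g) / 2))) / 2.
Proof.
move=> Sf Sg; have SD := subspaceD lS Sf Sg; have SB := subspaceB lS Sf Sg.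
have i1 := bmf_integrable P (gspace_bmf_sin (th - eta + pi / 2) SB).
have i2 := bmf_integrable P (gspace_bmf_sin (th + eta + pi / 2) SD).
rewrite -!(sinDpihalf (_ + _)) -!gspace_char// -RintegralB//.
rewrite -RintegralZr//; last first.
  have := integrableB measurableT i1 i2.
  by apply: eq_integrable => // w _; rewrite /= -EFinB.
apply: eq_Rintegral => w _.
rewrite (_ : th - eta + _ + _ = (th + f w) - (eta + g w) + pi / 2); last first.
  by rewrite !fctE; ring.
rewrite (_ : th + eta + _ + _ = (th + f w) + (eta + g w) + pi / 2); last first.
  by rewrite !fctE; ring.
rewrite !sinDpihalf; set a := th + f w; set b := eta + g w.
by rewrite cosB cosD; field.
Qed.

(** The Gram matrix may be singular, so solvability of the normal equations is checked against its
    cokernel: a null vector y gives z = sum y_i v_i with <z, z> = 0, whence <h, z> = 0. *)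
Lemma gspace_projection n (v : 'I_n -> T -> R) h :
  (forall i, S (v i)) -> S h ->
  exists c : 'I_n -> R, forall i, ip (h - \sum_j c j *: v j) (v i) = 0.
Proof.
move=> Sv Sh.
pose M := \matrix_(i < n, j < n) ip (v i) (v j).
pose b := \row_(j < n) ip h (v j).
have /submxP[c bE] : (b <= M)%MS.
  rewrite submxE; apply/eqP/rowP => k; rewrite !mxE.
  pose y i := cokermx M i k; pose z := \sum_i y i *: v i.
  have Sz : S z by apply: subspace_sum => // i; exact: subspaceZ.
  have zv i : ip z (v i) = 0.
    rewrite /z ip_suml//.
    have /matrixP/(_ i k) := mulmx_coker M; rewrite !mxE => H; rewrite -[RHS]H.
    by apply: eq_bigr => j _; rewrite [M _ _]mxE mulrC ipC.
  have z0 : ip z z = 0.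
    by rewrite {1}/z ip_suml//= big1// => i _; rewrite ipC zv mulr0.
  have := ip_eq0 Sz Sh z0; rewrite ipC.
  rewrite {1}/z ipC ip_suml// => H; rewrite -[RHS]H.
  by apply: eq_bigr => i _; rewrite [b _ _]mxE mulrC ipC.
exists (fun j => c 0 j) => i.
have Ss : S (\sum_j c 0 j *: v j) by apply: subspace_sum => // j; exact: subspaceZ.
rewrite ipBl// ip_suml//; have /rowP/(_ i) := bE; rewrite !mxE => ->.
by apply/eqP; rewrite subr_eq0; apply/eqP/eq_bigr => j _; rewrite !mxE.
Qed.

End inside_gaussian_space.

(** Polarization reduces the inner product to second moments of [u n + g] and [u n - g], which
    converge by [cgauss_cvg]. *)
Lemma ip_cvg S u f g : gspace S -> (forall n, S (u n)) -> S g ->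
  (forall w, u n w @[n --> \oo] --> f w) -> ip (u n) g @[n --> \oo] --> ip f g.
Proof.
move=> gS Su Sg uf; have gcS := gspace_pointwise_closure gS.
have cS := @sub_pointwise_closure S.
have cf : pointwise_closure S f by exists u.
have polar h k : pointwise_closure S h -> pointwise_closure S k ->
    ip h k = 4^-1 * (ip (h + k) (h + k) - ip (h - k) (h - k)).
  by move=> Sh Sk; rewrite (ip_sqrD gcS)// (ip_sqrB gcS)//; field.
rewrite (polar f g cf (cS _ Sg)).
under eq_fun do rewrite (polar _ _ (cS _ (Su _)) (cS _ Sg)) !ip_sqr.
rewrite !ip_sqr; apply: cvgM; first exact: cvg_cst.
apply: cvgB.
- apply: (cgauss_cvg (Z_ := fun n => u n + g) _ _).2.
    by move=> n; apply: gS.2; apply: subspaceD => //; exact: gS.1.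
  by move=> w; apply: cvgD; [exact: uf|exact: cvg_cst].
- apply: (cgauss_cvg (Z_ := fun n => u n - g) _ _).2.
    by move=> n; apply: gS.2; apply: subspaceB => //; exact: gS.1.
  by move=> w; apply: cvgB; [exact: uf|exact: cvg_cst].
Qed.

Lemma sigma_family_measurable (d' : measure_display) (E : measurableType d')
    (I : Type) (D : set I) (Z : I -> T -> E) A :
  (forall i, D i -> measurable_fun setT (Z i)) -> sigma_family D Z A ->
  measurable A.
Proof.
move=> mZ; apply: smallest_sub; first exact: sigma_algebra_measurable.
by move=> _ [i Di [B mB <-]]; exact: mZ.
Qed.

(** Orthogonality factorizes the integrals of products of sines. Two uses of [trig_uniqueness] pass
    to events, one variable at a time: first with weight sin(eta + g) minus its mean, then with
    weight the indicator of [A] minus its probability. *)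
Lemma gspace_independence S S1 S2 A C : gspace S ->
  linear_subspace S1 -> linear_subspace S2 -> S1 `<=` S -> S2 `<=` S ->
  (forall f g, S1 f -> S2 g -> ip f g = 0) ->
  sigma_family S1 id A -> sigma_family S2 id C ->
  P (A `&` C) = (P A * P C)%E.
Proof.
move=> gS l1 l2 s1 s2 orth sA sC.
have m1 f : S1 f -> measurable_fun setT f by move=> /s1; exact: gspace_measurable.
have m2 f : S2 f -> measurable_fun setT f by move=> /s2; exact: gspace_measurable.
have mA : measurable A by exact: (sigma_family_measurable m1 sA).
have mC : measurable C by exact: (sigma_family_measurable m2 sC).
have bsub (k : T -> R) (c : R) : bmf k -> bmf (fun w : T => k w - c).
  move=> bk; have := bmfD bk (bmf_cst T (- c)).
  by congr bmf; apply/funext => w; rewrite !fctE.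
have intM (k l : T -> R) : bmf k -> bmf l ->
    P.-integrable setT (EFin \o (fun w => k w * l w)).
  by move=> bk bl; apply: bmf_integrable; exact: bmfM.
have intB (k l : T -> R) c : bmf k -> bmf l ->
    \int[P]_w (k w * (l w - c)) = \int[P]_w (k w * l w) - c * \int[P]_w k w.
  move=> bk bl; rewrite -RintegralZl//; last exact: bmf_integrable.
  rewrite -RintegralB//; [|exact: intM|].
    by apply: eq_Rintegral => w _; ring.
  have := integrableZl measurableT c (bmf_integrable P bk).
  by apply: eq_integrable => // w _; rewrite /= EFinM.
have sin_sin f g th eta : S1 f -> S2 g ->
    \int[P]_w (sin (th + f w) * sin (eta + g w)) =
    (\int[P]_w sin (eta + g w)) * \int[P]_w sin (th + f w).
  move=> S1f S2g; have Sf := s1 _ S1f; have Sg := s2 _ S2g.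
  rewrite (gspace_sin_sin gS)// !(gspace_char gS)// (ip_sqrB gS)// (ip_sqrD gS)//.
  rewrite (orth _ _ S1f S2g) mulr0 subr0 addr0 cosB cosD.
  have -> : - ((ip f f + ip g g) / 2) = - (ip g g / 2) + - (ip f f / 2) by field.
  by rewrite expRD; field.
have sinA g eta : S2 g ->
    \int[P]_w (\1_A w * sin (eta + g w)) = fine (P A) * \int[P]_w sin (eta + g w).
  move=> S2g; set K := \int[P]_w sin (eta + g w).
  have bg : bmf (fun w => sin (eta + g w)) by exact: (gspace_bmf_sin gS _ (s2 _ S2g)).
  have ik := bmf_integrable P (bsub _ K bg).
  have := @trig_uniqueness _ _ _ _ _ (Rintegral_bounded_functional ik) l1 m1 _ _ sA.
  rewrite intB//; last exact: bmf_indic.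
  rewrite -(Rintegral_indic P mA) mulrC => H; apply/eqP; rewrite -subr_eq0.
  apply/eqP/H => f th S1f; rewrite intB//; last exact: (gspace_bmf_sin gS _ (s1 _ S1f)).
  by rewrite sin_sin// subrr.
have bA : bmf (\1_A : T -> R) by exact: bmf_indic.
have ik := bmf_integrable P (bsub _ (fine (P A)) bA).
have := @trig_uniqueness _ _ _ _ _ (Rintegral_bounded_functional ik) l2 m2 _ _ sC.
rewrite intB//; last exact: bmf_indic.
move=> H; rewrite -(Rintegral_indic P mA) -(Rintegral_indic P mC).
rewrite -Rintegral_indic; last exact: measurableI.
rewrite -EFinM; congr EFin; apply/eqP; rewrite -subr_eq0; apply/eqP.
have <- : \int[P]_w (\1_C w * \1_A w : R) = \int[P]_w \1_(A `&` C) w.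
  by apply: eq_Rintegral => w _; rewrite setIC indicI.
rewrite -[in RHS]H.
  by rewrite -(Rintegral_indic P mA).
move=> g eta S2g; rewrite intB//; last exact: (gspace_bmf_sin gS _ (s2 _ S2g)).
by under eq_Rintegral do rewrite mulrC; rewrite sinA// subrr.
Qed.

End gaussian_space.

(** * Conditions as limits of Riemann sums *)

Lemma eq_cvg_eq (R : realType) (u v : nat -> R) (l m : R) : u =1 v ->
  u n @[n --> \oo] --> l -> v n @[n --> \oo] --> m -> l = m.
Proof. by move=> /funext -> ul vm; rewrite -(cvg_lim _ ul)// (cvg_lim _ vm). Qed.

Section riemann_sums.
Context (R : realType).
Implicit Types (p q x : R) (f : R -> R) (n k : nat).

Definition cell p n k : set R :=
  `[p + k%:R / n.+1%:R, p + k.+1%:R / n.+1%:R[%classic.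

(* The minimum keeps the tags of the cells beyond q inside [p, q]. *)
Definition tag p q n k : R := Num.min (p + k%:R / n.+1%:R) q.

(** Cells have width 1/(n+1), so these cover a half-open interval from p of length truncn(q - p) +
    1. That length exceeds q - p, so the endpoint q is included. *)
Definition ncells p q n : nat := (n.+1 * (Num.truncn (q - p)).+1)%N.

Let index p n x : nat := Num.truncn ((x - p) * n.+1%:R).

Let cellE p n k x : p <= x -> (x \in cell p n k) = (k == index p n x).
Proof.
move=> px; have n0 : 0 < n.+1%:R :> R by [].
have /truncn_itv : 0 <= (x - p) * n.+1%:R by rewrite mulr_ge0 ?subr_ge0.
rewrite -/(index p n x) => /andP[i1 i2].
apply/idP/eqP => [|->].
  rewrite inE /cell /= in_itv/= -lerBrDl -ltrBlDl ler_pdivrMr// ltr_pdivlMr//.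
  move=> /andP[k1 k2]; apply/eqP; rewrite eqn_leq -[(k <= _)%N]ltnS -[(_ <= k)%N]ltnS.
  by rewrite -(ltr_nat R k) (le_lt_trans k1 i2) -(ltr_nat R) (le_lt_trans i1 k2).
by rewrite inE /cell /= in_itv/= -lerBrDl -ltrBlDl ler_pdivrMr// ltr_pdivlMr// i1.
Qed.

Let index_lt p q n x : p <= x <= q -> (index p n x < ncells p q n)%N.
Proof.
move=> /andP[px xq]; rewrite -(ltr_nat R) natrM.
have /truncn_itv/andP[i1 _] : 0 <= (x - p) * n.+1%:R by rewrite mulr_ge0 ?subr_ge0.
rewrite (le_lt_trans i1)// mulrC ltr_pM2l//.
by rewrite (le_lt_trans _ (truncnS_gt _))// lerB.
Qed.

Lemma tag_itv p q n k : p <= q -> p <= tag p q n k <= q.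
Proof.
move=> pq; rewrite /tag le_min pq andbT ge_min lexx orbT andbT.
by rewrite lerDl divr_ge0.
Qed.

Let tag_index p q n x : p <= x <= q ->
  `|x - tag p q n (index p n x)| <= n.+1%:R^-1.
Proof.
move=> /andP[px xq]; have n0 : 0 < n.+1%:R :> R by [].
have /truncn_itv : 0 <= (x - p) * n.+1%:R by rewrite mulr_ge0 ?subr_ge0.
rewrite -/(index p n x) -ler_pdivrMr// -ltr_pdivlMr//.
rewrite -[(index p n x).+1%:R]natr1 mulrDl mul1r.
set y := _ / _; move=> /andP[y1 y2].
rewrite /tag -/y min_l; last by lra.
set z := _^-1 in y2 *; clearbody y z; rewrite ger0_norm; lra.
Qed.

Definition step p q f n x : R :=
  \sum_(k < ncells p q n) f (tag p q n k) * \1_(cell p n k) x.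

Lemma stepE p q f n x : p <= x <= q ->
  step p q f n x = f (tag p q n (index p n x)).
Proof.
move=> pxq; have /andP[px _] := pxq.
rewrite /step (bigD1 (Ordinal (index_lt n pxq)))//= big1 => [|k kn].
  by rewrite indicE cellE// eqxx mulr1 addr0.
by rewrite indicE cellE// (negbTE (_ : _ != _)) ?mulr0.
Qed.

Lemma step_cvg p q f x : {within `[p, q], continuous f} -> p <= x <= q ->
  step p q f n x @[n --> \oo] --> f x.
Proof.
move=> /subspace_continuousP cf pxq; under eq_fun do rewrite stepE//.
have px : `[p, q]%classic x by rewrite /= in_itv.
have /andP[pq1 pq2] := pxq; have pq := le_trans pq1 pq2.
have tag_cvg : tag p q n (index p n x) @[n --> \oo] --> x.
  apply/cvgrPdist_le => e e0; near=> n; rewrite (le_trans (tag_index _ _))// ltW//.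
  by near: n; exact: (near_infty_natSinv_lt (PosNum e0)).
apply: (cvg_comp _ f _ (cf x px)) => B xB.
have H : \forall n \near \oo, `[p, q]%classic (tag p q n (index p n x)) ->
    B (tag p q n (index p n x)) by exact: (tag_cvg _ xB).
apply: (filterS _ H) => n h; apply: h.
by rewrite /= in_itv/= tag_itv.
Unshelve. all: by end_near. Qed.

Lemma continuous_itv_bounded p q f : {within `[p, q], continuous f} ->
  exists C, forall x, p <= x <= q -> `|f x| <= C.
Proof.
move=> cf; have := compact_bounded (continuous_compact cf (@segment_compact R p q)).
move=> [M [_ /(_ (M + 1))]]; rewrite ltrDl ltr01 => /(_ isT) HM.
by exists (M + 1) => x pxq; apply: HM; exists x.
Qed.

Lemma measurable_cell p n k : measurable (cell p n k).
Proof. exact: measurable_itv. Qed.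

Section riemann_sum_measure.
Variables (p q : R) (D : set (measurableTypeR R)).
Hypothesis mD : measurable D.
Hypothesis Dpq : D `<=` `[p, q].

Lemma Rintegral_riemann (mu : {finite_measure set (measurableTypeR R) -> \bar R}) f :
  {within `[p, q], continuous f} ->
  \sum_(k < ncells p q n) fine (mu (D `&` cell p n k)) * f (tag p q n k)
    @[n --> \oo] --> \int[mu]_(x in D) f x.
Proof.
move=> cf; have [C fC] := continuous_itv_bounded cf.
have Dx x : D x -> p <= x <= q by move=> /Dpq; rewrite /= in_itv.
have iC : mu.-integrable D (cst C%:E) by exact: finite_measure_integrable_cst.
have mstep n : measurable_fun D (step p q f n).
  apply: measurable_sum => k; apply: measurable_funM => //.
  by apply: measurable_indic; exact: measurable_cell.
have [] := @dominated_convergence _ _ _ mu D mD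
  (fun n x => (step p q f n x)%:E) (fun x => (f x)%:E) (cst C%:E).
- by move=> n; apply/measurable_EFinP.
- apply/measurable_EFinP; apply: (measurable_fun_cvg mstep) => x /Dx.
  exact: step_cvg.
- apply: aeW => x /Dx pxq; apply: cvg_EFin; first exact: nearW.
  exact: step_cvg.
- exact: iC.
- apply: aeW => x n /Dx pxq; rewrite /= lee_fin stepE// fC// tag_itv//.
  by have /andP[/le_trans h /h] := pxq.
move=> intf _ intcvg.
have ind n k : mu.-integrable D (fun x => (\1_(cell p n k) x)%:E).
  apply: (integrableS measurableT) => //.
  exact: (integrable_indic mu (measurable_cell p n k)).
have find n k : mu.-integrable D
    (fun x => (f (tag p q n k) * \1_(cell p n k) x)%:E).
  have := integrableZl mD (f (tag p q n k)) (ind n k).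
  by apply: eq_integrable => // x _; rewrite /= EFinM.
have sumE n : \sum_(k < ncells p q n) fine (mu (D `&` cell p n k)) * f (tag p q n k) =
    fine (\int[mu]_(x in D) (step p q f n x)%:E)%E.
  rewrite /step; under eq_integral do rewrite -sumEFin.
  rewrite integral_sum// -sum_fine => [|k _]; last exact: integrable_fin_num.
  apply: eq_bigr => k _; under eq_integral do rewrite EFinM.
  rewrite integralZl// integral_indic//; last exact: measurable_cell.
  rewrite setIC mulrC fineM// fin_num_measure//; apply: measurableI => //.
  exact: measurable_cell.
under eq_fun do rewrite sumE.
by apply: fine_cvg; rewrite fineK//; exact: integrable_fin_num.
Qed.

Definition charge_sum (a : condition R) f n : R :=
  \sum_(k < ncells p q n) fine (a (D `&` cell p n k)) * f (tag p q n k).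

(** The sums involve only the values of the charge, not the chosen Hahn decomposition. Identities
    between integrals against different charges, or over different sets, are therefore proved by
    comparing Riemann sums. *)
Lemma charge_integral_riemann (a : condition R) f :
  {within `[p, q], continuous f} ->
  charge_sum a f n @[n --> \oo] --> charge_integral a D f.
Proof.
move=> cf; rewrite /charge_integral /=.
set aPN := (X in jordan_pos X).
pose pos : {finite_measure set (measurableTypeR R) -> \bar R} := jordan_pos aPN.
pose neg : {finite_measure set (measurableTypeR R) -> \bar R} := jordan_neg aPN.
have := cvgB (Rintegral_riemann (mu := pos) cf) (Rintegral_riemann (mu := neg) cf).
suff -> : charge_sum a f =
    (fun n => \sum_(k < ncells p q n) fine (pos (D `&` cell p n k)) * f (tag p q n k)) -
    (fun n => \sum_(k < ncells p q n) fine (neg (D `&` cell p n k)) * f (tag p q n k)).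
  exact.
apply/funext => n; rewrite !fctE /charge_sum -sumrB.
apply: eq_bigr => k _; rewrite -mulrBl.
have mDk : measurable (D `&` cell p n k).
  by apply: measurableI => //; exact: measurable_cell.
rewrite (jordan_decomp aPN mDk) /cadd /= cscaleN1 fineD ?fin_numN ?fin_num_measure//.
by rewrite fineN.
Qed.

End riemann_sum_measure.

End riemann_sums.

Section charge_integrals.
Context (R : realType) (T : R) (f : R -> R).
Hypothesis cf : {within `[0, T], continuous f}.

Definition dirac_condition (t : R) : condition R :=
  charge_of_finite_measure (@dirac _ (measurableTypeR R) t R).

Lemma charge_integral_dirac (t : R) : 0 <= t <= T ->
  charge_integral (dirac_condition t) `[0, T] f = f t.
Proof.
move=> t0T; have mD : measurable (`[0, T]%classic : set (measurableTypeR R)).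
  exact: measurable_itv.
have sub : (`[0, T] `<=` `[0, T]) by [].
apply: eq_cvg_eq (charge_integral_riemann mD sub (a := dirac_condition t) cf)
  (step_cvg cf t0T) => n; apply: eq_bigr => k _; rewrite mulrC; congr (_ * _).
rewrite (_ : dirac_condition t _ = (t \in `[0, T] `&` cell 0 n k)%:R%:E); last first.
  exact: diracE.
rewrite indicE in_setI.
by rewrite [X in X && _]mem_set//= in_itv.
Qed.

Lemma charge_integral_restr (a : condition R) (D : set (measurableTypeR R))
  (mD : measurable D) : D `<=` `[0, T] ->
  charge_integral (crestr a mD) `[0, T] f = charge_integral a D f.
Proof.
move=> DT; have mT : measurable (`[0, T]%classic : set (measurableTypeR R)).
  exact: measurable_itv.
have sub : (`[0, T] `<=` `[0, T]) by [].
apply: eq_cvg_eq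
  (charge_integral_riemann mT sub (a := crestr a mD : condition R) cf)
  (charge_integral_riemann mD DT (a := a) cf) => n.
apply: eq_bigr => k _; congr (fine (a _) * _).
by rewrite setIAC [_ `&` D](setIidr DT).
Qed.

Lemma charge_integralU (a : condition R) (D1 D2 : set (measurableTypeR R)) :
  measurable D1 -> measurable D2 -> D1 `&` D2 = set0 -> D1 `|` D2 `<=` `[0, T] ->
  charge_integral a (D1 `|` D2) f = charge_integral a D1 f + charge_integral a D2 f.
Proof.
move=> m1 m2 D120 DT; have mU := measurableU _ _ m1 m2.
have D1T : D1 `<=` `[0, T] by move=> x D1x; apply: DT; left.
have D2T : D2 `<=` `[0, T] by move=> x D2x; apply: DT; right.
apply: eq_cvg_eq (charge_integral_riemann mU DT (a := a) cf)
  (cvgD (charge_integral_riemann m1 D1T (a := a) cf)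
    (charge_integral_riemann m2 D2T (a := a) cf)) => n.
rewrite /charge_sum -big_split; apply: eq_bigr => k _ /=; rewrite -mulrDl.
have mc : measurable (cell 0 n k : set (measurableTypeR R)).
  exact: measurable_cell.
have mc1 := measurableI _ _ m1 mc; have mc2 := measurableI _ _ m2 mc.
rewrite setIUl chargeU// ?fineD ?fin_num_measure//.
by rewrite setIACA D120 set0I.
Qed.

End charge_integrals.

(** * Processes and conditional expectations *)

Section process_spaces.
Context (R : realType) (d : measure_display) (Omega : measurableType d)
  (P : probability Omega R).
Implicit Types (D : set R) (X : R -> Omega -> R) (S : set (Omega -> R)).

Definition process_span D X : set (Omega -> R) :=
  [set Z | exists2 s : seq (R * R), forall p, p \in s -> D p.1 &
    Z = \sum_(p <- s) p.2 *: X p.1].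

Definition process_space D X := pointwise_closure (process_span D X).

Lemma process_span_subspace D X : linear_subspace (process_span D X).
Proof.
split; first by exists [::]; rewrite ?big_nil.
move=> c _ _ [s sD ->] [r rD ->].
exists ([seq (p.1, c * p.2) | p <- s] ++ r).
  by move=> p; rewrite mem_cat => /orP[/mapP[q /sD + ->]//|/rD].
rewrite big_cat big_map /= scaler_sumr; congr (_ + _).
by apply: eq_bigr => p _; rewrite scalerA.
Qed.

Lemma process_span_mem D X t : D t -> process_span D X (X t).
Proof.
move=> Dt; exists [:: (t, 1)]; last by rewrite big_seq1 scale1r.
by move=> p; rewrite inE => /eqP ->.
Qed.

Lemma process_span_sub D X S : linear_subspace S -> (forall t, D t -> S (X t)) ->
  process_span D X `<=` S.
Proof.
move=> lS SX _ [s sD ->]; elim: s sD => [|p s IH] sD.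
  by rewrite big_nil; exact: lS.1.
rewrite big_cons; apply: lS.2.
  by apply: SX; apply: sD; rewrite mem_head.
by apply: IH => q qs; apply: sD; rewrite inE qs orbT.
Qed.

Lemma process_space_subspace D X : linear_subspace (process_space D X).
Proof. by apply: pointwise_closure_subspace; exact: process_span_subspace. Qed.

Lemma process_space_mem D X t : D t -> process_space D X (X t).
Proof. by move=> Dt; apply: sub_pointwise_closure; exact: process_span_mem. Qed.

Lemma process_spaceS D D' X : D `<=` D' -> process_space D X `<=` process_space D' X.
Proof.
move=> DD' f [u uD uf]; exists u => // n; move: (uD n).
apply: process_span_sub; first exact: process_span_subspace.
by move=> t /DD'; exact: process_span_mem.
Qed.

Lemma process_space_measurable D X Z : (forall t, D t -> measurable_fun setT (X t)) ->
  process_space D X Z -> measurable_fun setT Z.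
Proof.
move=> mX [u uD uZ]; apply: (measurable_fun_cvg (h := u)) => [n|w _]; last exact: uZ.
have [s sD ->] := uD n; elim: s sD => [|p s IH] sD.
  by rewrite big_nil; exact: (measurable_cst (0 : R)).
rewrite big_cons; apply: measurable_funD.
  apply: measurable_funM => //; apply: mX; apply: sD; exact: mem_head.
by apply: IH => q qs; apply: sD; rewrite inE qs orbT.
Qed.

Lemma gspace_process_span D X : gaussian_family P D X ->
  (forall t, D t -> ('E_P[X t] = 0)%E) -> gspace P (process_span D X).
Proof.
move=> gX cX; split; first exact: process_span_subspace.
have gXt t : D t -> cgauss P (X t).
  move=> Dt; apply: gaussian_rv_cgauss; last exact: cX.
  have := gX 1%N (fun=> t) (fun=> 1) (fun=> Dt).
  by congr gaussian_rv; apply/funext => w; rewrite big_ord1 mul1r.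
move=> Z DZ; apply: gaussian_rv_cgauss.
  case: DZ => s sD ->.
  have sDk k : D (tnth (in_tuple s) k).1.
    by apply: sD; exact: (mem_tnth k (in_tuple s)).
  have := gX (size s) (fun k => (tnth (in_tuple s) k).1)
    (fun k => (tnth (in_tuple s) k).2) sDk.
  congr gaussian_rv; apply/funext => w; rewrite fct_sumE.
  by rewrite [in RHS](big_tnth _ _ (in_tuple s)).
have [iZ Z0] : P.-integrable setT (EFin \o Z) /\ \int[P]_w Z w = 0.
  pose S := [set f : Omega -> R |
    P.-integrable setT (EFin \o f) /\ \int[P]_w f w = 0].
  apply: (@process_span_sub D X S _ _ _ DZ); last first.
    by move=> t /gXt gt; split; [exact: cgauss_integrable|exact: cgauss_mean0].
  split; first by split; [exact: finite_measure_integrable_cst|exact: Rintegral_prob_cst].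
  move=> c f g [fi f0] [gi g0].
  have icf : P.-integrable setT (EFin \o (fun w => c * f w)).
    have := integrableZl measurableT c fi.
    by apply: eq_integrable => // w _; rewrite /= EFinM.
  split.
    have := integrableD measurableT icf gi.
    by apply: eq_integrable => // w _; rewrite /= -EFinD.
  transitivity (\int[P]_w (c * f w + g w)); first by [].
  by rewrite RintegralD// RintegralZl// f0 g0 mulr0 addr0.
rewrite unlock -[LHS]fineK; first by rewrite [fine _]Z0.
exact: integrable_fin_num.
Qed.

Lemma ip_process_space_eq0 S D X Z : gspace P S -> S Z -> process_span D X `<=` S ->
  (forall x, D x -> ip P Z (X x) = 0) ->
  forall m, process_space D X m -> ip P Z m = 0.
Proof.
move=> gS SZ XS Z0 m [u uD um].
have u0 n : ip P (u n) Z = 0.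
  pose S' := [set f | S f /\ ip P f Z = 0].
  suff : S' (u n) by case.
  apply: (@process_span_sub D X S' _ _ _ (uD n)); last first.
    by move=> t Dt; split; [apply: XS; exact: process_span_mem|rewrite ipC Z0].
  split; first by split; [exact: gS.1.1|exact: ip0l].
  move=> c f g [Sf f0] [Sg g0]; split; first exact: gS.1.2.
  by rewrite (ip_linear gS)// f0 g0 mulr0 addr0.
have := ip_cvg gS (fun n => XS _ (uD n)) SZ um.
under eq_fun do rewrite u0.
by move=> m0; rewrite ipC -(cvg_lim _ m0)// lim_cst.
Qed.

(** All tags lie in [p, q], so the Riemann sums are combinations of the process at these times. This
    is what places an integral in the past or in the future of a time. *)
Lemma charge_integral_process_space (T p q : R) (A : set (measurableTypeR R))
    (a : condition R) X :
  (forall w, {within `[0, T], continuous (X ^~ w)}) ->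
  0 <= p -> p <= q -> q <= T -> measurable A -> A `<=` `[p, q] ->
  process_space `[p, q] X (fun w => charge_integral a A (X ^~ w)).
Proof.
move=> cX p0 pq qT mA Apq.
have cX' w : {within `[p, q], continuous (X ^~ w)}.
  apply: continuous_subspaceW (cX w) => x /=; rewrite !in_itv/=.
  by move=> /andP[px xq]; rewrite (le_trans p0 px) (le_trans xq qT).
exists (fun n w => charge_sum p q A a (X ^~ w) n); last first.
  by move=> w; exact: charge_integral_riemann.
move=> n.
rewrite (_ : (fun w => _) = \sum_(k < ncells p q n)
    fine (a (A `&` cell p n k)) *: X (tag p q n k)); last first.
  by apply/funext => w; rewrite fct_sumE.
have lX := process_span_subspace `[p, q] X.
apply: subspace_sum => // k; apply: subspaceZ => //; apply: process_span_mem.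
by rewrite /= in_itv/= tag_itv.
Qed.

End process_spaces.

Section conditional_expectations.
Context (R : realType) (d : measure_display) (Omega : measurableType d)
  (P : probability Omega R).
Implicit Types (G : set (set Omega)) (Y Z f k : Omega -> R).

Lemma Rintegral_indicM A f : measurable A ->
  \int[P]_(w in A) f w = \int[P]_w (\1_A w * f w).
Proof.
move=> mA; rewrite Rintegral_mkcond; apply: eq_Rintegral => w _.
by rewrite patchE indicE; case: (w \in A); rewrite ?mul1r ?mul0r.
Qed.

Lemma Rintegral_mul_indic_eq0 k f : bmf k -> P.-integrable setT (EFin \o f) ->
  (forall B : set R, measurable B -> \int[P]_w (\1_(f @^-1` B) w * k w) = 0) ->
  \int[P]_w (f w * k w) = 0.
Proof.
move=> bk fi f0; have [mk [C kC]] := bk.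
have mf : measurable_fun setT f by apply/measurable_EFinP; exact: measurable_int fi.
have bPhi := Rintegral_bounded_functional (bmf_integrable P bk).
(* [f] is only integrable, so it is approximated by bounded functions of itself: [g n y] tends to y
   and never exceeds |y| in absolute value. *)
pose g n (y : R) : R := n.+1%:R * sin (y * n.+1%:R^-1).
have mg n : measurable_fun setT (g n).
  by apply: measurable_funM => //; apply: measurable_sin; exact: measurable_funM.
have bg n : bmf (g n \o f).
  split; first exact: measurableT_comp.
  exists n.+1%:R => w /=; rewrite normrM normr_nat ler_piMr//; exact: sin_max.
have g0 n : \int[P]_w (g n (f w) * k w) = 0.
  apply: (bounded_functional_indic bPhi (bg n)) => B mB.
  by rewrite comp_preimage; apply: f0; rewrite -[X in measurable X]setTI; exact: mg.
have h0 : n.+1%:R^-1 @[n --> \oo] --> (0 : R).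
  by rewrite gtr0_cvgV0; [rewrite cvg_shiftS; exact: cvgr_idn|exact: nearW].
have gle n y : `|g n y| <= `|y|.
  rewrite normrM normr_nat -ler_pdivlMl// mulrC.
  by rewrite (le_trans (norm_sin_le _))// normrM gtr0_norm.
have ifk : P.-integrable setT (fun w => (f w * k w)%:E).
  have := bmf_integrableM bk fi.
  by apply: eq_integrable => // w _; rewrite /= mulrC.
have cvg0 : \int[P]_w (g n (f w) * k w) @[n --> \oo] --> (0 : R).
  by under eq_fun do rewrite g0; exact: cvg_cst.
apply: (cvg_unique _ _ cvg0) => //; apply: fine_cvg; rewrite fineK; last first.
  exact: integrable_fin_num.
have [] := @dominated_convergence _ _ _ P setT measurableT
  (fun n w => (g n (f w) * k w)%:E) (fun w => (f w * k w)%:E)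
  (fun w => C%:E * (abse \o (EFin \o f)) w)%E => //.
- by move=> n; apply/measurable_EFinP; apply: measurable_funM => //; exact: (bg n).1.
- by apply/measurable_EFinP; exact: measurable_funM.
- apply: aeW => w _; apply: cvg_EFin; first exact: nearW.
  apply: cvgM; last exact: cvg_cst.
  have := cvg_diff_quotient0 (y := f w) (is_derive_sin 0) (@sin0 R) h0 (fun n => _).
  rewrite cos0 mulr1 => H; have {}H := H (fun n => invr_neq0 (lt0r_neq0 (ltr0Sn R n))).
  by move: H; under eq_fun do rewrite invrK mulrC.
- by apply: integrableZl => //; exact: integrable_abse.
- apply: aeW => w n _; rewrite /= lee_fin normrM mulrC.
  by rewrite ler_pM.
Qed.

Lemma cond_exp_mul G Y Z f : is_cond_exp P G Y Z -> bmf f ->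
  (forall B : set R, measurable B -> G (f @^-1` B)) ->
  \int[P]_w (f w * Y w) = \int[P]_w (f w * Z w).
Proof.
move=> [iY iZ ZG YZ] bf fG.
have b1 := Rintegral_bounded_functional iY.
have b2 := Rintegral_bounded_functional iZ.
apply/eqP; rewrite -subr_eq0; apply/eqP.
apply: (bounded_functional_indic (bounded_functionalB b1 b2) bf) => B mB.
have mfB : measurable (f @^-1` B).
  by rewrite -[X in measurable X]setTI; exact: bf.1.
by rewrite -!Rintegral_indicM// /Rintegral YZ ?subrr//; exact: fG.
Qed.

Lemma cond_exp_measurable G Y Z : is_cond_exp P G Y Z -> measurable_fun setT Z.
Proof. by move=> [_ iZ _ _]; apply/measurable_EFinP; exact: measurable_int iZ. Qed.

Lemma preimage_sigma_family (d' : measure_display) (E : measurableType d')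
    (I : Type) (D : set I) (V : I -> Omega -> E) i (B : set E) :
  D i -> measurable B -> sigma_family D V (V i @^-1` B).
Proof.
move=> Di mB; apply: sub_sigma_algebra; exists i => //.
by exists B => //; rewrite setTI.
Qed.

Lemma sigma_family_fun (E : pointedType) (G : set (set E)) (f : E -> R) :
  (measurable_fun (setT : set (g_sigma_algebraType G)) f) ->
  forall B : set R, measurable B -> <<s G >> (f @^-1` B).
Proof. by move=> mf B mB; rewrite -[f @^-1` B]setTI; exact: mf. Qed.

End conditional_expectations.

(** * Covariance form of the Markov property *)

Section markov_covariance.
Context (R : realType) (d : measure_display) (Omega : measurableType d)
  (P : probability Omega R) (T : R) (X : R -> Omega -> R).
Hypothesis gX : gspace P (process_span `[0, T] X).
Hypothesis markovX : markov_process P T X.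

(* If [X u] vanishes almost surely the quotient is 0 by convention, and the
   identity then says that the past and the future of u are uncorrelated. *)
Lemma markov_ip (s u t : R) : 0 <= s -> s <= u -> u <= t -> t <= T ->
  ip P (X t) (X s) = ip P (X s) (X u) / ip P (X u) (X u) * ip P (X t) (X u).
Proof.
move=> s0 su ut tT.
have SX r : 0 <= r -> r <= T -> process_span `[0, T] X (X r).
  by move=> r0 rT; apply: process_span_mem; rewrite /= in_itv/= r0.
have u0 := le_trans s0 su; have t0 := le_trans u0 ut.
have uT := le_trans ut tT; have sT := le_trans su uT.
have Ss := SX s s0 sT; have Su := SX u u0 uT; have St := SX t t0 tT.
(* [c *: X u] is the regression of [X s] on [X u], and [v] below is the variance of the remainder.
   Bounded sines stand in for [X s], since the Markov property speaks of events. *)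
have lS := gX.1; set c := _ / _.
have cu : c * ip P (X u) (X u) = ip P (X s) (X u).
  rewrite /c; have [uu0|uu0] := eqVneq (ip P (X u) (X u)) 0; last by rewrite divfK.
  by rewrite uu0 mulr0 ipC (ip_eq0 gX).
have Scu : process_span `[0, T] X (c *: X u) by exact: subspaceZ.
pose v := ip P (X s) (X s) - c ^+ 2 * ip P (X u) (X u).
pose k w := sin (X s w) - expR (- (v / 2)) * sin (c * X u w).
have sinE (f g : Omega -> R) th : process_span `[0, T] X f ->
    process_span `[0, T] X g ->
    \int[P]_w (sin (th + f w) * sin (g w)) =
    cos th * (expR (- (ip P f f + ip P g g - 2 * ip P f g) / 2) -
     expR (- (ip P f f + ip P g g + 2 * ip P f g) / 2)) / 2.
  move=> Sf Sg; have := gspace_sin_sin gX th 0 Sf Sg.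
  rewrite subr0 addr0 (ip_sqrB gX)// (ip_sqrD gX)// !mulNr -mulrBr => <-.
  by apply: eq_Rintegral => w _; rewrite add0r.
have bsin f : process_span `[0, T] X f -> bmf (fun w => sin (f w)).
  by move=> Sf; apply: bmf_sin; exact: (gspace_measurable gX).
have bk : bmf k.
  have := bmfD (bsin _ Ss) (bmfZ (- expR (- (v / 2))) (bsin _ Scu)).
  by congr bmf; apply/funext => w; rewrite !fctE /GRing.scale /= /k mulNr.
have ik := bmf_integrable P bk.
have intk (g : Omega -> R) : bmf g -> \int[P]_w (g w * k w) =
    \int[P]_w (g w * sin (X s w)) -
    expR (- (v / 2)) * \int[P]_w (g w * sin (c * X u w)).
  move=> bg; have i1 := bmf_integrable P (bmfM bg (bsin _ Ss)).
  have i2 := bmf_integrable P (bmfM bg (bsin _ Scu)).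
  rewrite -RintegralZl// -RintegralB//.
    by apply: eq_Rintegral => w _; rewrite /k; ring.
  have := integrableZl measurableT (expR (- (v / 2))) i2.
  by apply: eq_integrable => // w _; rewrite /= EFinM.
(* [k] is sin(X s) minus its conditional expectation given X u. *)
have kXu C : sigma_family [set u] X C -> \int[P]_w (\1_C w * k w) = 0.
  pose S1 : set (Omega -> R) := [set f | exists l, f = l *: X u].
  have lS1 : linear_subspace S1.
    split; first by exists 0; rewrite scale0r.
    by move=> e _ _ [l ->] [m ->]; exists (e * l + m); rewrite scalerDl scalerA.
  have mS1 f : S1 f -> measurable_fun setT f.
    by move=> [l ->]; apply: (gspace_measurable gX); exact: subspaceZ.
  move=> sC; apply: (trig_uniqueness (Rintegral_bounded_functional ik) lS1 mS1).
    move=> _ th [l ->]; have Sl : process_span `[0, T] X (l *: X u) by exact: subspaceZ.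
    rewrite intk; last exact: (gspace_bmf_sin gX).
    rewrite (sinE _ (X s))// (sinE _ (c *: X u))//.
    rewrite !(ipZl gX)// !(ipZr gX)// (ipC P (X u) (X s)) -cu.
    rewrite /v; set uu := ip P (X u) (X u); set ss := ip P (X s) (X s).
    have e1 : expR (- (l * (l * uu) + ss - 2 * (l * (c * uu))) / 2) =
        expR (- ((ss - c ^+ 2 * uu) / 2)) *
        expR (- (l * (l * uu) + c * (c * uu) - 2 * (l * (c * uu))) / 2).
      by rewrite -expRD; congr expR; field.
    have e2 : expR (- (l * (l * uu) + ss + 2 * (l * (c * uu))) / 2) =
        expR (- ((ss - c ^+ 2 * uu) / 2)) *
        expR (- (l * (l * uu) + c * (c * uu) + 2 * (l * (c * uu))) / 2).
      by rewrite -expRD; congr expR; field.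
    by rewrite e1 e2; ring.
  apply: smallest_sub sC; first exact: smallest_sigma_algebra.
  move=> _ [_ -> [B mB <-]]; apply: sub_sigma_algebra; exists (X u).
    by exists 1; rewrite scale1r.
  by exists B.
have kF (B : set R) : measurable B -> sigma_family `[0, u] X (k @^-1` B).
  apply: sigma_family_fun; rewrite /k.
  pose G := g_sigma_algebraType (\bigcup_(i in `[0, u]) g_sigma_algebra_preimage (X i)).
  have mX r : 0 <= r -> r <= u -> measurable_fun (setT : set G) (X r).
    move=> r0 ru _ A mA; rewrite setTI; apply: preimage_sigma_family => //.
    by rewrite /= in_itv/= r0.
  apply: measurable_funB; first by apply: measurable_sin; exact: mX.
  apply: measurable_funM => //; apply: measurable_sin; apply: measurable_funM => //.
  exact: mX.
(* [k] belongs to the past of u, so the Markov property replaces the indicator by the common version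
   [Z]. As [Z] is measurable for [X u], [kXu] applies to its preimages. *)
have kXt (B : set R) : measurable B -> \int[P]_w (\1_(X t @^-1` B) w * k w) = 0.
  move=> mB; have [_ /(_ u t B u0 ut tT mB)[Z [Z1 Z2]]] := markovX.
  transitivity (\int[P]_w (k w * \1_(X t @^-1` B) w)).
    by apply: eq_Rintegral => w _; rewrite mulrC.
  rewrite (cond_exp_mul Z1 bk kF).
  transitivity (\int[P]_w (Z w * k w)).
    by apply: eq_Rintegral => w _; rewrite mulrC.
  have [_ iZ ZX _] := Z2.
  apply: Rintegral_mul_indic_eq0 => // A mA; apply: kXu.
  have [C mC CE] : g_sigma_algebra_preimage (X u) (Z @^-1` A).
    by apply: ZX; exists A => //; rewrite setTI.
  by rewrite -CE setTI; apply: preimage_sigma_family.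
(* Computed from the Gaussian characteristic function, this single equation contains the claimed
   identity. *)
have : \int[P]_w (sin (X t w) * k w) = 0.
  apply: (bounded_functional_indic (Rintegral_bounded_functional ik) (bsin _ St)).
  move=> B mB; have -> : (fun w => sin (X t w)) @^-1` B = X t @^-1` (@sin R @^-1` B) by [].
  apply: kXt; rewrite -[X in measurable X]setTI.
  by have := continuous_measurable_fun (@continuous_sin R); exact.
rewrite intk//; last exact: bsin.
have sinE0 g : process_span `[0, T] X g -> \int[P]_w (sin (X t w) * sin (g w)) =
    (expR (- (ip P (X t) (X t) + ip P g g - 2 * ip P (X t) g) / 2) -
     expR (- (ip P (X t) (X t) + ip P g g + 2 * ip P (X t) g) / 2)) / 2.
  move=> Sg; have := sinE (X t) g 0 St Sg; rewrite cos0 mul1r => <-.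
  by apply: eq_Rintegral => w _; rewrite add0r.
rewrite (sinE0 (X s))// (sinE0 (c *: X u))// (ipZl gX)// !(ipZr gX)//.
set tt := ip P (X t) (X t); set ss := ip P (X s) (X s); set uu := ip P (X u) (X u).
set x := ip P (X t) (X s); set y := ip P (X t) (X u).
have -> : - (tt + ss - 2 * x) / 2 = - (tt + ss) / 2 + x by field.
have -> : - (tt + ss + 2 * x) / 2 = - (tt + ss) / 2 + - x by field.
have -> : - (tt + c * (c * uu) - 2 * (c * y)) / 2 =
  (- (tt + ss) / 2 + v / 2) + c * y by rewrite /v -/ss -/uu; field.
have -> : - (tt + c * (c * uu) + 2 * (c * y)) / 2 =
  (- (tt + ss) / 2 + v / 2) + - (c * y) by rewrite /v -/ss -/uu; field.
rewrite !expRD (expRN (v / 2)) => H.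
(* After division by the common exponential factors, this says that x and c y have the same
   hyperbolic sine, which is strictly increasing. *)
have {}H : expR x - expR (- x) = expR (c * y) - expR (- (c * y)).
  have e1 := expR_gt0 (- (tt + ss) / 2); have e2 := expR_gt0 (v / 2).
  have : expR (- (tt + ss) / 2) *
    ((expR x - expR (- x)) - (expR (c * y) - expR (- (c * y)))) = 0.
    rewrite -[RHS](mulr0 2) -H; field; exact: lt0r_neq0.
  by move=> /eqP; rewrite mulf_eq0 gt_eqF//= subr_eq0 => /eqP.
have [xy|xy|//] := ltgtP x (c * y).
  have h1 : expR x < expR (c * y) by rewrite ltr_expR.
  have h2 : expR (- (c * y)) < expR (- x) by rewrite ltr_expR ltrN2.
  by lra.
have h1 : expR (c * y) < expR x by rewrite ltr_expR.
have h2 : expR (- x) < expR (- (c * y)) by rewrite ltr_expR ltrN2.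
by lra.
Qed.

End markov_covariance.

(** * Gaussian conditioning and independence *)

Section gaussian_conditioning.
Context (R : realType) (d : measure_display) (Omega : measurableType d)
  (P : probability Omega R).

(** Independence makes the integral the probability of [A] times the mean of [W], which is 0. As [W]
    is unbounded, events are reached through [Rintegral_mul_indic_eq0]. *)
Lemma gspace_indep_integral (S S1 S2 : set (Omega -> R)) A W : gspace P S ->
  linear_subspace S1 -> linear_subspace S2 -> S1 `<=` S -> S2 `<=` S ->
  (forall f g, S1 f -> S2 g -> ip P f g = 0) ->
  sigma_family S1 id A -> S2 W -> \int[P]_w (\1_A w * W w) = 0.
Proof.
move=> gS l1 l2 s1 s2 orth sA SW.
have mA : measurable A.
  by apply: (sigma_family_measurable _ sA) => f /s1; exact: (gspace_measurable gS).
have gW := gS.2 _ (s2 _ SW); have iW := cgauss_integrable gW.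
have bA : bmf (\1_A : Omega -> R) by exact: bmf_indic.
pose k (w : Omega) : R := \1_A w - fine (P A).
have bk : bmf k by have := bmfD bA (bmf_cst Omega (- fine (P A))); congr bmf.
have : \int[P]_w (W w * k w) = 0.
  apply: Rintegral_mul_indic_eq0 => // B mB.
  have sWB : sigma_family S2 id (W @^-1` B) by exact: (preimage_sigma_family (V := id)).
  have mWB : measurable (W @^-1` B).
    by rewrite -[X in measurable X]setTI; apply: (gspace_measurable gS (s2 _ SW)).
  have bWB : bmf (\1_(W @^-1` B) : Omega -> R) by exact: bmf_indic.
  have i1 := bmf_integrable P (bmfM bWB bA); have i2 := bmf_integrable P bWB.
  transitivity (\int[P]_w (\1_(A `&` (W @^-1` B)) w - fine (P A) * \1_(W @^-1` B) w)).
    by apply: eq_Rintegral => w _; rewrite indicI /k /=; ring.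
  rewrite RintegralB//; first last.
  - have := integrableZl measurableT (fine (P A)) i2.
    by apply: eq_integrable => // w _; rewrite /= EFinM.
  - by apply: bmf_integrable; apply: bmf_indic; exact: measurableI.
  rewrite RintegralZl//; apply: EFin_inj; rewrite EFinB EFinM.
  rewrite !Rintegral_indic ?fineK ?fin_num_measure//; last exact: measurableI.
  rewrite (gspace_independence gS l1 l2 s1 s2 orth sA sWB).
  by rewrite subee// fin_numM// fin_num_measure.
move=> H; rewrite -[RHS]H -[LHS]subr0 -(mulr0 (fine (P A))) -(cgauss_mean0 gW).
rewrite -RintegralZl// -RintegralB//.
- by apply: eq_Rintegral => w _; rewrite /k; ring.
- exact: bmf_integrableM.
- have := integrableZl measurableT (fine (P A)) iW.
  by apply: eq_integrable => // w _; rewrite /= EFinM.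
Qed.

(** The remainder h - L, with L the projection, is independent of the conditioning variables, so Z -
    L integrates to zero over each of their events. *)
Lemma gaussian_cond_exp (S : set (Omega -> R)) n (G : 'I_n -> Omega -> R) h Z
    (b : 'I_n -> R) : gspace P S -> (forall i, S (G i)) -> S h ->
  (forall i, ip P (h - \sum_j b j *: G j) (G i) = 0) ->
  is_cond_exp P (sigma_family setT G) h Z ->
  {ae P, forall w, Z w = (\sum_j b j *: G j) w}.
Proof.
move=> gS SG Sh; set L := \sum_j _ => orth condZ.
have [ih iZ ZG hZ] := condZ.
pose S1 := [set f | exists c : 'I_n -> R, f = \sum_j c j *: G j].
pose S2 := [set f | exists l : R, f = l *: (h - L)].
have SL : S L by apply: subspace_sum => [|i]; [exact: gS.1|apply: subspaceZ => //; exact: gS.1].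
have SW : S (h - L) by apply: subspaceB => //; exact: gS.1.
have l1 : linear_subspace S1.
  split; first by exists (fun=> 0); rewrite big1// => i _; rewrite scale0r.
  move=> c _ _ [e ->] [e' ->]; exists (fun i => c * e i + e' i).
  rewrite scaler_sumr -big_split; apply: eq_bigr => i _.
  by rewrite scalerDl scalerA.
have l2 : linear_subspace S2.
  split; first by exists 0; rewrite scale0r.
  by move=> e _ _ [l ->] [m ->]; exists (e * l + m); rewrite scalerDl scalerA.
have s1 : S1 `<=` S.
  move=> _ [c ->]; apply: subspace_sum; first exact: gS.1.
  by move=> i; apply: subspaceZ => //; exact: gS.1.
have s2 : S2 `<=` S by move=> _ [l ->]; apply: subspaceZ => //; exact: gS.1.
have orth12 f g : S1 f -> S2 g -> ip P f g = 0.
  move=> [c ->] [l ->]; rewrite (ip_suml gS)//; last exact: s2 (ex_intro _ l erefl).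
  by rewrite big1// => i _; rewrite (ipZr gS)// ipC orth !mulr0.
have SS1 : sigma_family setT G `<=` sigma_family S1 id.
  apply: smallest_sub; first exact: smallest_sigma_algebra.
  move=> _ [i _ [B mB <-]]; rewrite setTI; apply: (preimage_sigma_family (V := id)) => //.
  exists (fun j => (j == i)%:R); rewrite (bigD1 i)//= eqxx scale1r big1 ?addr0// => j.
  by move=> /negbTE ->; rewrite scale0r.
have iL : P.-integrable setT (EFin \o L) by apply: cgauss_integrable; exact: gS.2.
pose D w := Z w - L w.
have iD : P.-integrable setT (EFin \o D).
  have := integrableB measurableT iZ iL.
  by apply: eq_integrable => // w _; rewrite /= -EFinB.
have sigD (B : set R) : measurable B -> sigma_family setT G (D @^-1` B).
  apply: sigma_family_fun; apply: measurable_funB.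
    move=> _ A mA; rewrite setTI; apply: ZG; exists A => //.
    by rewrite setTI.
  rewrite (_ : L = fun w => \sum_j b j * G j w); last first.
    by apply/funext => w; rewrite /L fct_sumE.
  apply: measurable_sum => i; apply: measurable_funM => // _ A mA.
  by rewrite setTI; apply: preimage_sigma_family.
have D0 A : sigma_family setT G A -> \int[P]_w (\1_A w * D w) = 0.
  move=> GA; have mA : measurable A.
    apply: (sigma_family_measurable _ GA) => i _; exact: (gspace_measurable gS).
  have bA : bmf (\1_A : Omega -> R) by exact: bmf_indic.
  have hW := gspace_indep_integral gS l1 l2 s1 s2 orth12 (SS1 _ GA)
    (ex_intro _ 1 (esym (scale1r (h - L)))).
  have hE : \int[P]_w (\1_A w * Z w) = \int[P]_w (\1_A w * h w).
    by rewrite -!Rintegral_indicM// /Rintegral hZ.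
  have ihA := bmf_integrableM bA ih; have iZA := bmf_integrableM bA iZ.
  have iLA := bmf_integrableM bA iL.
  transitivity (\int[P]_w (\1_A w * Z w) - \int[P]_w (\1_A w * L w)).
    by rewrite -RintegralB//; apply: eq_Rintegral => w _; rewrite mulrBr.
  rewrite hE -RintegralB// -[RHS]hW; apply: eq_Rintegral => w _.
  by rewrite -mulrBr !fctE.
have : (\int[P]_w `|(D w)%:E| = 0)%E.
  (* [D] is itself measurable for the conditioning variables, so the events where it is positive and
     negative are admissible. Together they give the integral of |D|. *)
  pose A := D @^-1` `]0, +oo[; pose B := D @^-1` `]-oo, 0[.
  have GA : sigma_family setT G A by apply: sigD; exact: measurable_itv.
  have GB : sigma_family setT G B by apply: sigD; exact: measurable_itv.
  have mG C : sigma_family setT G C -> bmf (\1_C : Omega -> R).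
    move=> GC; apply: bmf_indic.
    apply: (sigma_family_measurable _ GC) => i _; exact: (gspace_measurable gS).
  have iA := bmf_integrableM (mG _ GA) iD; have iB := bmf_integrableM (mG _ GB) iD.
  have : \int[P]_w `|D w| = 0.
    transitivity (\int[P]_w (\1_A w * D w) - \int[P]_w (\1_B w * D w)); last first.
      by rewrite D0// D0// subrr.
    rewrite -RintegralB//; apply: eq_Rintegral => w _.
    have inA : (w \in A) = (0 < D w).
      by apply/idP/idP => [/set_mem|?]; rewrite ?inE /A /= in_itv/= andbT.
    have inB : (w \in B) = (D w < 0).
      by apply/idP/idP => [/set_mem|?]; rewrite ?inE /B /= in_itv.
    rewrite !indicE inA inB; case: (ltgtP 0 (D w)) => [?|?|<-].
    - by rewrite gtr0_norm// mulr0n mulr1n mul0r mul1r subr0.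
    - by rewrite ltr0_norm// mulr0n mulr1n mul0r mul1r sub0r.
    - by rewrite normr0 !mulr0 subr0.
  move=> H; rewrite -[LHS]fineK; first by rewrite [fine _]H.
  by apply: integrable_fin_num => //; exact: integrable_abse.
move=> /(ae_eq_integral_abs P measurableT (measurable_int P iD)).
by apply: filterS => w /(_ I)[] /eqP; rewrite subr_eq0 => /eqP.
Qed.

End gaussian_conditioning.

(** * Conditional expectations of functions of independent variables *)

Section independent_section.
Context (R : realType) (d : measure_display) (Omega : measurableType d)
  (P : probability Omega R).
Context (d1 : measure_display) (E1 : measurableType d1)
  (d2 : measure_display) (E2 : measurableType d2).
Variables (F : set (set Omega)) (U : Omega -> E1) (W : Omega -> E2).
Hypothesis sF : sigma_algebra setT F.
Hypothesis mF : F `<=` measurable.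
Hypothesis FU : forall B, measurable B -> F (U @^-1` B).
Hypothesis mW : measurable_fun setT W.
Hypothesis indep : forall A B, F A -> measurable B ->
  P (A `&` W @^-1` B) = (P A * P (W @^-1` B))%E.

Let mU : measurable_fun setT U.
Proof. by move=> _ B mB; rewrite setTI; apply: mF; exact: FU. Qed.

Let FC A : F A -> F (~` A).
Proof. by move=> FA; rewrite -setTD; case: sF => _ FD _; exact: FD. Qed.

Let FI A B : F A -> F B -> F (A `&` B).
Proof. by have /sigma_algebraP[//|_ _ _ FI] := sF; exact: FI. Qed.

Let FUn A B : F A -> F B -> F (A `|` B).
Proof. by move=> FA FB; rewrite -[A]setCK -[B]setCK -setCI; apply/FC/FI; exact: FC. Qed.

(* Pairing U with the indicator of A turns the claim into Fubini's theorem for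
   a product of two probability laws. *)
Lemma independent_section A (C : set (E1 * E2)) : F A -> measurable C ->
  P (A `&` [set w | C (U w, W w)]) =
  (\int[P]_(w in A) P (W @^-1` xsection C (U w)))%E.
Proof.
move=> FA mC; have mA := mF FA.
pose V w := (U w, w \in A).
have VtrueE : (fun w => w \in A) @^-1` [set true] = A.
  by apply/seteqP; split => w /=; [move/set_mem|move/mem_set].
have mb : measurable_fun setT (fun w => w \in A).
  by apply: (measurable_fun_bool true); rewrite setTI VtrueE.
have mV : measurable_fun setT V by exact: measurable_fun_pair.
have mVW : measurable_fun setT (fun w => (V w, W w)) by exact: measurable_fun_pair.
pose Vm := HB.pack_for {mfun Omega >-> (E1 * bool)%type} V
  (isMeasurableFun.Build _ _ _ _ V mV).
pose Wm := HB.pack_for {mfun Omega >-> E2} W (isMeasurableFun.Build _ _ _ _ W mW).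
pose VWm := HB.pack_for {mfun Omega >-> ((E1 * bool) * E2)%type} (fun w => (V w, W w))
  (isMeasurableFun.Build _ _ _ _ _ mVW).
pose C' : set ((E1 * bool) * E2) :=
  [set z : (E1 * bool) * E2 | z.1.2 /\ C (z.1.1, z.2)].
have mC' : measurable C'.
  have -> : C' = (fun z => z.1.2) @^-1` [set true] `&`
      (fun z => (z.1.1, z.2)) @^-1` C by [].
  apply: measurableI.
    rewrite -[X in measurable X]setTI.
    by apply: (measurableT_comp measurable_snd measurable_fst).
  rewrite -[X in measurable X]setTI.
  apply: measurable_fun_pair => //.
  exact: (measurableT_comp measurable_fst measurable_fst).
have FV (B : set (E1 * bool)) : measurable B -> F (V @^-1` B).
  (* A set of pairs splits along the boolean into two sections, one taken over [A] and the other
     over its complement. *)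
  move=> mB; have -> : V @^-1` B = (A `&` U @^-1` ysection B true) `|`
      (~` A `&` U @^-1` ysection B false).
    apply/seteqP; split => w; rewrite /V /=.
      rewrite /ysection /=; have [wA Bw|/negP wA Bw] := boolP (w \in A).
        by left; split; [exact/set_mem|rewrite inE].
      by right; split; [move=> /mem_set|rewrite inE].
    rewrite /ysection /=; move=> [[Aw]|[Aw]]; rewrite inE.
      by rewrite mem_set.
    by rewrite memNset.
  apply: FUn; apply: FI => //; first by apply: FU; exact: measurable_ysection.
    exact: FC.
  by apply: FU; exact: measurable_ysection.
have joint (B1 : set (E1 * bool)) (B2 : set E2) : measurable B1 -> measurable B2 ->
    distribution P VWm (B1 `*` B2) = (distribution P Vm B1 * distribution P Wm B2)%E.
  by move=> mB1 mB2; rewrite -[RHS]indep//; exact: FV.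
have H := product_measure_unique joint mC'.
transitivity (distribution P VWm C').
  congr (P _); apply/seteqP; split => w /=.
    by move=> [Aw Cw]; split => //=; exact/mem_set.
  by move=> [/set_mem].
rewrite -[LHS]H /product_measure1 /=.
rewrite ge0_integral_pushforward//; last first.
  by apply: measurable_fun_xsection.
rewrite preimage_setT [RHS]integral_mkcond; apply: eq_integral => w _ /=.
rewrite patchE /distribution /pushforward /=; case: ifPn => wA; last first.
  rewrite (_ : _ @^-1` _ = set0) ?measure0//; apply/seteqP; split => // z.
  by rewrite /xsection /= inE /C' /V /= (negbTE wA) => -[].
congr (P _); apply/seteqP; split => z; rewrite /xsection /= !inE /C' /V /= wA.
  by case.
by split.
Qed.

End independent_section.

(** The version does not depend on [F]. Applied to the whole past and to the sigma-algebra of V_s,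
    it yields the common version that [markov_process] asks for. *)
Lemma independent_cond_exp (R : realType) (d : measure_display)
    (Omega : measurableType d) (P : probability Omega R)
    (d1 : measure_display) (E1 : measurableType d1)
    (d2 : measure_display) (E2 : measurableType d2)
    (F : set (set Omega)) (U : Omega -> E1) (W : Omega -> E2) (C : set (E1 * E2)) :
  sigma_algebra setT F -> F `<=` measurable ->
  (forall B, measurable B -> F (U @^-1` B)) -> measurable_fun setT W ->
  (forall A B, F A -> measurable B ->
    P (A `&` W @^-1` B) = (P A * P (W @^-1` B))%E) ->
  measurable C ->
  is_cond_exp P F \1_[set w | C (U w, W w)]
    (fun w => fine (P (W @^-1` xsection C (U w)))).
Proof.
move=> sF mF FU mW indep mC.
pose z (v : E1) : R := fine (P (W @^-1` xsection C v)).
have mWx v : measurable (W @^-1` xsection C v).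
  by rewrite -[X in measurable X]setTI; apply: mW => //; exact: measurable_xsection.
pose Wm := HB.pack_for {mfun Omega >-> E2} W (isMeasurableFun.Build _ _ _ _ W mW).
have mz : measurable_fun setT z.
  apply: measurableT_comp; first exact: fine_measurable.
  exact: (measurable_fun_xsection (distribution P Wm) mC).
have mU : measurable_fun setT U by move=> _ B mB; rewrite setTI; apply: mF; exact: FU.
have bz : bmf (fun w => z (U w)).
  split; first exact: measurableT_comp.
  exists 1 => w; rewrite ger0_norm ?fine_ge0// -lee_fin fineK ?fin_num_measure//.
  exact: probability_le1.
have mUW : measurable [set w | C (U w, W w)].
  rewrite -[X in measurable X]setTI.
  by have := measurable_fun_pair mU mW; apply.
split.
- by apply: bmf_integrable; exact: bmf_indic.
- exact: bmf_integrable.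
- move=> _ [B mB <-]; rewrite setTI -[X in F X]/(U @^-1` (z @^-1` B)).
  by apply: FU; rewrite -[X in measurable X]setTI; exact: mz.
- move=> A FA; rewrite integral_indic//; last exact: mF.
  rewrite setIC; apply: etrans (esym (independent_section sF mF FU mW indep FA mC)).
  by apply: eq_integral => w _; rewrite fineK// fin_num_measure.
Qed.

(** * The conditioned process *)

Section conditioning_transfer.
Context (R : realType) (T : R) (d : measure_display) (Omega : measurableType d)
  (P : probability Omega R) (X : R -> Omega -> R)
  (N : nat) (a : 'I_N -> condition R)
  (d' : measure_display) (Omega' : measurableType d')
  (P' : probability Omega' R) (Y : R -> Omega' -> R).
Hypothesis T0 : 0 <= T.
Hypothesis cX : forall w, {within `[0, T], continuous (X ^~ w)}.
Hypothesis gX : gspace P (process_span `[0, T] X).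
Hypothesis condY : is_conditioned_process T P X a P' Y.

Let gSX : gspace P (process_space `[0, T] X) := gspace_pointwise_closure gX.

Lemma apply_condition_process_space (dO : measure_display) (O : measurableType dO)
    (Z : R -> O -> R) b : (forall w, {within `[0, T], continuous (Z ^~ w)}) ->
  process_space `[0, T] Z (apply_condition T b Z).
Proof.
by move=> cZ; apply: (charge_integral_process_space _ cZ) => //; exact: measurable_itv.
Qed.

Let XA b := apply_condition_process_space b cX.

Lemma residual_subproof b : exists c : 'I_N -> R, forall i,
  ip P (apply_condition T b X - \sum_j c j *: apply_condition T (a j) X)
       (apply_condition T (a i) X) = 0.
Proof. exact: (gspace_projection gSX (fun i => XA (a i)) (XA b)). Qed.

(** A singular Gram matrix leaves the coefficients undetermined, so they are chosen. By
    [gaussian_cond_exp] the subtracted sum agrees almost surely with every version of the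
    conditional expectation. *)
Definition residual b : Omega -> R := apply_condition T b X -
  \sum_j projT1 (cid (residual_subproof b)) j *: apply_condition T (a j) X.

Lemma residual_orthogonal b i : ip P (residual b) (apply_condition T (a i) X) = 0.
Proof. by rewrite /residual; case: cid => c /=; apply. Qed.

Lemma residual_process_space b : process_space `[0, T] X (residual b).
Proof.
have lS := gSX.1; apply: subspaceB => //; apply: subspace_sum => // j.
exact: subspaceZ.
Qed.

(** The equality of laws transfers the integral of the sine of any combination to X, where the
    versions Z may be replaced by projections. The resulting characteristic function gives both
    claims through [cgauss_of_charfun]. *)
Lemma conditioned_comb n (b : 'I_n -> condition R) (c : 'I_n -> R) :
  cgauss P' (\sum_k c k *: apply_condition T (b k) Y) /\
  ip P' (\sum_k c k *: apply_condition T (b k) Y)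
        (\sum_k c k *: apply_condition T (b k) Y) =
  ip P (\sum_k c k *: residual (b k)) (\sum_k c k *: residual (b k)).
Proof.
have [[_ cY] /(_ n b)[Z [condZ lawZ]]] := condY.
pose f (v : n.-tuple R) := \sum_k c k * tnth v k.
pose YY w := [tuple apply_condition T (b k) Y w | k < n].
pose XX w := [tuple apply_condition T (b k) X w - Z k w | k < n].
have mf : measurable_fun setT f.
  apply: measurable_sum => k; apply: measurable_funM => //.
  exact: measurable_tnth.
have mYY : measurable_fun setT YY.
  apply/measurable_fun_tnthP => k; rewrite (_ : _ \o _ = apply_condition T (b k) Y).
    apply: (process_space_measurable _ (apply_condition_process_space (b k) cY)).
    move=> t Dt; have [+ _] := condY.1.1 1%N (fun=> t) (fun=> 1) (fun=> Dt).
    by congr measurable_fun; apply/funext => w; rewrite big_ord1 mul1r.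
  by apply/funext => w /=; rewrite tnth_mktuple.
have mXX : measurable_fun setT XX.
  apply/measurable_fun_tnthP => k.
  rewrite (_ : _ \o _ = (fun w => apply_condition T (b k) X w - Z k w)).
    apply: measurable_funB; first exact: (gspace_measurable gSX).
    exact: (cond_exp_measurable (condZ k)).
  by apply/funext => w /=; rewrite tnth_mktuple.
have lawE (g : n.-tuple R -> R) : bmf g ->
    \int[P']_w g (YY w) = \int[P]_w g (XX w).
  move=> bg; apply/eqP; rewrite -subr_eq0; apply/eqP.
  apply: (bounded_functional_indic (bounded_functionalB
    (bounded_functional_comp P' mYY) (bounded_functional_comp P mXX)) bg) => B mB.
  have mgB : measurable (g @^-1` B).
    by rewrite -[X in measurable X]setTI; exact: bg.1.
  have indE (dO : measure_display) (O : measurableType dO) (p : probability O R)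
      (V : O -> n.-tuple R) : measurable_fun setT V ->
      \int[p]_w \1_(g @^-1` B) (V w) = fine (pushforward p V (g @^-1` B)).
    move=> mV; have mA : measurable (V @^-1` (g @^-1` B)).
      by rewrite -[X in measurable X]setTI; exact: mV.
    by rewrite -[RHS]/(fine (p _)) -(Rintegral_indic p mA).
  by rewrite !indE// lawZ// subrr.
have aeE : {ae P, forall w, f (XX w) = (\sum_k c k *: residual (b k)) w}.
  have : {ae P, forall w, forall k, Z k w =
      (\sum_j projT1 (cid (residual_subproof (b k))) j *: apply_condition T (a j) X) w}.
    apply: filter_forall => k.
    apply: (gaussian_cond_exp gSX (fun i => XA (a i)) (XA (b k)) _ (condZ k)).
    exact: residual_orthogonal.
  apply: filterS => w ZE; rewrite fct_sumE; apply: eq_bigr => k _.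
  by rewrite tnth_mktuple ZE.
have Sr : process_space `[0, T] X (\sum_k c k *: residual (b k)).
  have lS := gSX.1; apply: subspace_sum => // k; apply: subspaceZ => //.
  exact: residual_process_space.
have mr := gspace_measurable gSX Sr.
have mF (th l : R) : measurable_fun setT (fun v => sin (th + l * f v)).
  by apply: measurable_sin; apply: measurable_funD => //; exact: measurable_funM.
have YE : \sum_k c k *: apply_condition T (b k) Y = f \o YY.
  apply/funext => w; rewrite fct_sumE /=; apply: eq_bigr => k _.
  by rewrite tnth_mktuple.
rewrite YE [X in _ /\ X = _]ip_sqr.
apply: cgauss_of_charfun; first exact: measurableT_comp.
move=> th l; have bsin : bmf (fun v => sin (th + l * f v)).
  by split => //; exists 1 => v; exact: sin_max.
rewrite [LHS](lawE _ bsin).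
have -> : \int[P]_w sin (th + l * f (XX w)) =
    \int[P]_w sin (th + l * (\sum_k c k *: residual (b k)) w).
  congr fine; apply: ae_eq_integral => //.
  - by apply/measurable_EFinP; exact: (measurableT_comp (mF th l) mXX).
  - apply/measurable_EFinP; apply: measurable_sin; apply: measurable_funD => //.
    exact: measurable_funM.
  - by apply: filterS aeE => w -> _.
by have [_ _ ->] := gSX.2 _ Sr; rewrite ip_sqr.
Qed.

(** That Y is centred is read off its law at Dirac conditions. *)
Lemma gspace_conditioned : gspace P' (process_space `[0, T] Y).
Proof.
have [[gY cY] _] := condY.
apply: gspace_pointwise_closure; apply: gspace_process_span => // t t0T.
have YtE : Y t = apply_condition T (dirac_condition t) Y.
  apply/funext => w; rewrite /apply_condition (charge_integral_dirac (cY w))//.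
have [gt _] := conditioned_comb (fun _ : 'I_1 => dirac_condition t) (fun=> 1).
move: gt; rewrite big_ord1 scale1r -YtE => gt.
rewrite unlock -[LHS]fineK; first by rewrite [fine _](cgauss_mean0 gt).
by apply: integrable_fin_num => //; exact: cgauss_integrable gt.
Qed.

(** Polarization: [conditioned_comb] equates the variances for [b], for [b'] and for their sum. *)
Lemma conditioned_ip b b' :
  ip P' (apply_condition T b Y) (apply_condition T b' Y) =
  ip P (residual b) (residual b').
Proof.
have gSY := gspace_conditioned; have [[_ cY] _] := condY.
have Sb := apply_condition_process_space b cY.
have Sb' := apply_condition_process_space b' cY.
have sqr e : ip P' (apply_condition T e Y) (apply_condition T e Y) =
    ip P (residual e) (residual e).
  have [_] := conditioned_comb (fun _ : 'I_1 => e) (fun=> 1).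
  by rewrite !big_ord1 !scale1r.
have pair_sum (V : lmodType R) (u : condition R -> V) :
    \sum_(k < 2) 1 *: u (if k == ord0 then b else b') = u b + u b'.
  by rewrite !big_ord_recl big_ord0 /= addr0 !scale1r.
have [_] := conditioned_comb (fun k : 'I_2 => if k == ord0 then b else b') (fun=> 1).
rewrite (pair_sum _ (fun e => apply_condition T e Y)) (pair_sum _ residual).
rewrite (ip_sqrD gSY)// (ip_sqrD gSX).
- by rewrite !sqr => /addrI /(mulfI _); apply; rewrite pnatr_eq0.
- exact: residual_process_space.
- exact: residual_process_space.
Qed.

End conditioning_transfer.

Section augmented_coordinates.
Context (R : realType) (T : R) (N : nat) (a : 'I_N -> condition R)
  (d : measure_display) (Omega : measurableType d) (X : R -> Omega -> R).
Hypothesis cX : forall w, {within `[0, T], continuous (X ^~ w)}.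
Implicit Types s t : R.

Let mitv (s : R) : measurable (`[0, s]%classic : set (measurableTypeR R)).
Proof. exact: measurable_itv. Qed.

(** Presents each component of V_s as a condition on the whole of [0, T], the form in which the law
    of the conditioned process is given. *)
Definition augmented_condition (s : R) (l : 'I_N.+1) : condition R :=
  if unlift ord0 l is Some i then crestr (a i) (mitv s) else dirac_condition s.

Definition augmented_coord (s : R) (l : 'I_N.+1) : Omega -> R :=
  fun w => tnth (augmented_process a X s w) l.

Lemma augmented_coord0 s : augmented_coord s ord0 = X s.
Proof. by apply/funext => w; rewrite /augmented_coord tnth0. Qed.

Lemma augmented_coordS s i :
  augmented_coord s (lift ord0 i) = running_integral (a i) X s.
Proof. by apply/funext => w; rewrite /augmented_coord tnthS tnth_mktuple. Qed.

Lemma augmented_conditionE s l : 0 <= s <= T ->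
  apply_condition T (augmented_condition s l) X = augmented_coord s l.
Proof.
move=> sT; apply/funext => w; rewrite /apply_condition /augmented_condition.
case: unliftP => [i ->|->]; last first.
  by rewrite augmented_coord0; exact: charge_integral_dirac.
rewrite augmented_coordS; apply: charge_integral_restr => // x /=.
by rewrite !in_itv /= => /andP[-> /le_trans]; apply; case/andP: sT.
Qed.

Lemma augmented_process_space s l : 0 <= s <= T ->
  process_space `[0, s] X (augmented_coord s l).
Proof.
move=> /andP[s0 sT]; case: (unliftP ord0 l) => [i ->|->].
  rewrite augmented_coordS.
  exact: (charge_integral_process_space (T := T) (p := 0) (q := s)).
by rewrite augmented_coord0; apply: process_space_mem; rewrite /= in_itv/= s0 lexx.
Qed.

(** The increment is an integral over ]s, t]: an atom of the condition at s is already counted in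
    the component at time s. *)
Lemma running_integral_split i s t : 0 <= s -> s <= t -> t <= T ->
  process_space `[s, T] X
    (running_integral (a i) X t - augmented_coord s (lift ord0 i)).
Proof.
move=> s0 st tT.
rewrite augmented_coordS (_ : _ - _ = fun w => charge_integral (a i) `]s, t] (X ^~ w)).
  apply: (charge_integral_process_space _ cX) => //.
  - exact: le_trans tT.
  - move=> x /=; rewrite !in_itv/= => /andP[/ltW -> xt]; exact: le_trans xt tT.
apply/funext => w; rewrite !fctE /running_integral.
have -> : `[0, t]%classic = `[0, s] `|` `]s, t] :> set R.
  by rewrite -itv_bndbnd_setU// bnd_simp.
pose A : set (measurableTypeR R) := `[0, s]%classic.
pose B : set (measurableTypeR R) := `]s, t]%classic.
have AB : charge_integral (a i) (A `|` B) (X ^~ w) =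
    charge_integral (a i) A (X ^~ w) + charge_integral (a i) B (X ^~ w).
  apply: (charge_integralU (T := T)) => //; rewrite ?/A ?/B.
  - exact: measurable_itv.
  - exact: measurable_itv.
  - apply/seteqP; split => // x /=; rewrite !in_itv/= => -[/andP[_ xs] /andP[sx _]].
    by move: (lt_le_trans sx xs); rewrite ltxx.
  - move=> x [|] /=; rewrite !in_itv/=.
      by move=> /andP[-> /le_trans]; apply; exact: le_trans tT.
    by move=> /andP[/ltW/(le_trans s0) -> /le_trans]; exact.
rewrite -[RHS](addKr (charge_integral (a i) A (X ^~ w))) -AB; exact: addrC.
Qed.

End augmented_coordinates.

(** * Regression of the residuals on the past *)

Section regression.
Context (R : realType) (T : R) (d : measure_display) (Omega : measurableType d)
  (P : probability Omega R) (X : R -> Omega -> R)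
  (N : nat) (a : 'I_N -> condition R).
Hypothesis T0 : 0 <= T.
Hypothesis cX : forall w, {within `[0, T], continuous (X ^~ w)}.
Hypothesis gX : gspace P (process_span `[0, T] X).
Hypothesis markovX : markov_process P T X.
Implicit Types s t x : R.

Let gSX : gspace P (process_space `[0, T] X) := gspace_pointwise_closure gX.

Let SXt t : 0 <= t <= T -> process_space `[0, T] X (X t).
Proof. by move=> tT; apply: process_space_mem; rewrite /= in_itv. Qed.

Lemma markov_ip_future s x Z : 0 <= x -> x <= s -> s <= T ->
  process_space `[s, T] X Z ->
  ip P Z (X x) = ip P Z (X s) / ip P (X s) (X s) * ip P (X s) (X x).
Proof.
move=> x0 xs sT FZ; have s0 := le_trans x0 xs.
have xT := le_trans xs sT; have lS := gSX.1.
have Sx : process_space `[0, T] X (X x) by apply: SXt; rewrite x0.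
have Ss : process_space `[0, T] X (X s) by apply: SXt; rewrite s0.
have sub : `[s, T]%classic `<=` `[0, T]%classic.
  by move=> t /=; rewrite !in_itv/= => /andP[/(le_trans s0) -> ->].
have SZ := process_spaceS sub FZ.
pose c := ip P (X x) (X s) / ip P (X s) (X s).
have Sc : process_space `[0, T] X (c *: X s) by exact: subspaceZ.
have : ip P (X x - c *: X s) Z = 0.
  apply: (ip_process_space_eq0 gSX _ _ _ FZ); first exact: subspaceB.
    move=> f ff; apply: sub_pointwise_closure; move: f ff.
    apply: process_span_sub; first exact: process_span_subspace.
    by move=> t /sub; exact: process_span_mem.
  move=> t /= tsT; have /andP[st tT] : s <= t <= T by move: tsT; rewrite in_itv.
  have St : process_space `[0, T] X (X t) by apply: SXt; rewrite (le_trans s0 st).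
  rewrite (ipBl gSX)// (ipZl gSX)// (ipC _ (X x)) (markov_ip gX markovX x0 xs st tT).
  by rewrite (ipC _ (X s) (X t)) subrr.
rewrite (ipBl gSX)// (ipZl gSX)// => /eqP; rewrite subr_eq0 => /eqP.
rewrite ipC => ->; rewrite /c (ipC _ Z (X s)) (ipC _ (X x) (X s)); ring.
Qed.

(* On the past of s such a variable acts like a linear function of the
   augmented process at time s. *)
Definition past_reducible s : set (Omega -> R) := [set Z |
  process_space `[0, T] X Z /\ exists c : 'I_N.+1 -> R, forall x, 0 <= x <= s ->
    ip P Z (X x) = ip P (\sum_l c l *: augmented_coord a X s l) (X x)].

Lemma augmented_coord_mem s l : 0 <= s <= T ->
  process_space `[0, T] X (augmented_coord a X s l).
Proof.
move=> sT; apply: process_spaceS (augmented_process_space a cX l sT) => x /=.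
by rewrite !in_itv/= => /andP[-> /le_trans]; apply; case/andP: sT.
Qed.

Lemma past_reducible_subspace s : 0 <= s <= T -> linear_subspace (past_reducible s).
Proof.
move=> sT; have lS := gSX.1; have SV l := augmented_coord_mem l sT.
have SX x : 0 <= x <= s -> process_space `[0, T] X (X x).
  move=> /andP[x0 xs]; apply: SXt; rewrite x0/=.
  by apply: le_trans xs _; case/andP: sT.
split; first split; first exact: lS.1.
  by exists (fun=> 0) => x xs; rewrite big1// => l _; rewrite scale0r.
move=> e f g [Sf [c cE]] [Sg [c' cE']]; split; first exact: lS.2.
exists (fun l => e * c l + c' l) => x xs.
rewrite (ip_linear gSX)//; last exact: SX.
rewrite cE// cE'// !(ip_suml gSX)//; try exact: SX.
rewrite mulr_sumr -big_split; apply: eq_bigr => l _ /=; ring.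
Qed.

Lemma past_reducible_coord s l : 0 <= s <= T ->
  past_reducible s (augmented_coord a X s l).
Proof.
move=> sT; split; first exact: augmented_coord_mem.
exists (fun k => (k == l)%:R) => x _; rewrite (bigD1 l)//= eqxx scale1r.
by rewrite big1 ?addr0// => k /negbTE ->; rewrite scale0r.
Qed.

Lemma past_reducible_future s Z : 0 <= s <= T -> process_space `[s, T] X Z ->
  past_reducible s Z.
Proof.
move=> /andP[s0 sT] FZ; split.
  apply: process_spaceS FZ => t /=.
  by rewrite !in_itv/= => /andP[/(le_trans s0) -> ->].
exists (fun k => if k == ord0 then ip P Z (X s) / ip P (X s) (X s) else 0) => x.
move=> /andP[x0 xs]; rewrite (bigD1 ord0)//= big1 ?addr0; last first.
  by move=> k /negbTE ->; rewrite scale0r.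
rewrite augmented_coord0 (ipZl gSX); [exact: markov_ip_future| |].
  by apply: SXt; rewrite s0.
by apply: SXt; rewrite x0 (le_trans xs).
Qed.

Lemma past_reducible_running_integral s t i : 0 <= s -> s <= t -> t <= T ->
  past_reducible s (running_integral (a i) X t).
Proof.
move=> s0 st tT; have sT : 0 <= s <= T by rewrite s0 (le_trans st).
have := past_reducible_future sT (running_integral_split a cX i s0 st tT).
move=> /(subspaceD (past_reducible_subspace sT)) /(_ (past_reducible_coord _ sT)).
by move/(_ (lift ord0 i)); rewrite subrK.
Qed.

(** The condition is the running integral at time T. This covers the terms that conditioning
    subtracts in every residual. *)
Lemma past_reducible_condition s i : 0 <= s <= T ->
  past_reducible s (apply_condition T (a i) X).
Proof. by move=> /andP[s0 sT]; exact: (past_reducible_running_integral i s0 sT). Qed.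

Let res := residual a T0 cX gX.

Lemma past_reducible_residual s t l : 0 <= s -> s <= t -> t <= T ->
  past_reducible s (res (augmented_condition a t l)).
Proof.
move=> s0 st tT; have sT : 0 <= s <= T by rewrite s0 (le_trans st).
have tT' : 0 <= t <= T by rewrite tT (le_trans s0).
have lG := past_reducible_subspace sT.
rewrite /res /residual; apply: subspaceB => //; last first.
  apply: subspace_sum => // j; apply: subspaceZ => //.
  exact: past_reducible_condition.
rewrite augmented_conditionE//; case: (unliftP ord0 l) => [i ->|->].
  by rewrite augmented_coordS; exact: past_reducible_running_integral.
rewrite augmented_coord0; apply: past_reducible_future => //.
by apply: process_space_mem; rewrite /= in_itv/= st.
Qed.

Lemma residual_regression s t j : 0 <= s -> s <= t -> t <= T ->
  exists c : 'I_N.+1 -> R, forall x, 0 <= x <= s ->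
    ip P (res (augmented_condition a t j) -
          \sum_l c l *: res (augmented_condition a s l)) (X x) = 0.
Proof.
move=> s0 st tT; have sT : 0 <= s <= T by rewrite s0 (le_trans st).
have lG := past_reducible_subspace sT; have lS := gSX.1.
have Sres b : process_space `[0, T] X (res b) by exact: residual_process_space.
have [c cE] := gspace_projection gSX (fun l => Sres (augmented_condition a s l))
  (Sres (augmented_condition a t j)).
exists c; move: cE; set Q := _ - _ => cE.
have SA b : process_space `[0, T] X (apply_condition T b X).
  exact: apply_condition_process_space.
have SQ : process_space `[0, T] X Q.
  by apply: subspaceB => //; apply: subspace_sum => // l; exact: subspaceZ.
have [_ [e eE]] : past_reducible s Q.
  apply: subspaceB => //; first exact: past_reducible_residual.
  apply: subspace_sum => // l; apply: subspaceZ => //.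
  by apply: past_reducible_residual => //; exact: le_trans tT.
have ra b i : ip P (res b) (apply_condition T (a i) X) = 0.
  exact: residual_orthogonal.
have Qa i : ip P Q (apply_condition T (a i) X) = 0.
  rewrite (ipBl gSX)//; last first.
    by apply: subspace_sum => // l; exact: subspaceZ.
  rewrite ra [X in _ - X](ip_suml gSX)// big1 ?subrr// => l _.
  by rewrite ra mulr0.
(* The regression only makes [Q] orthogonal to the residuals at time s. The components themselves
   differ from these by combinations of the conditions, to which [Q] is orthogonal by [Qa]. *)
have QV l : ip P Q (augmented_coord a X s l) = 0.
  rewrite -(augmented_conditionE a cX l sT).
  set cs := augmented_condition a s l.
  pose b := projT1 (cid (residual_subproof a T0 cX gX cs)).
  have -> : apply_condition T cs X = res cs + \sum_i b i *: apply_condition T (a i) X.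
    by rewrite /res /residual subrK.
  rewrite (ipDr gSX)//; last by apply: subspace_sum => // i; exact: subspaceZ.
  rewrite cE add0r ipC (ip_suml gSX)// big1// => i _.
  by rewrite ipC Qa mulr0.
pose L := \sum_l e l *: augmented_coord a X s l.
have SV l := augmented_coord_mem l sT.
have SL : process_space `[0, T] X L.
  by apply: subspace_sum => // l; exact: subspaceZ.
have SX x : 0 <= x <= s -> process_space `[0, T] X (X x).
  move=> /andP[x0 xs]; apply: SXt; rewrite x0/=.
  by apply: le_trans xs _; case/andP: sT.
have PL : process_space `[0, s] X L.
  have ls := process_space_subspace `[0, s] X.
  apply: subspace_sum => // l; apply: subspaceZ => //.
  exact: augmented_process_space.
have QL : ip P Q L = 0.
  by rewrite ipC (ip_suml gSX)// big1// => l _; rewrite ipC QV mulr0.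
(* [Q] and [L] have the same covariances with the past, and [L] lies in the space of the past, so
   <L, L> = <Q, L> = 0. Thus [L], and with it [Q], has zero covariance with each X_x, x at most
   s. *)
have LL : ip P L L = 0.
  have : ip P (Q - L) L = 0.
    apply: (ip_process_space_eq0 gSX _ _ _ PL); first exact: subspaceB.
      apply: process_span_sub => // x /=; rewrite in_itv/=; exact: SX.
    move=> x /=; rewrite in_itv/= => xs.
    by rewrite (ipBl gSX)//; [rewrite eE// subrr|exact: SX].
  by rewrite (ipBl gSX)// QL sub0r => /eqP; rewrite oppr_eq0 => /eqP.
by move=> x xs; rewrite eE// (ip_eq0 gSX)//; exact: SX.
Qed.

End regression.

(** * Markov property of the augmented conditioned process *)

Section conditioned_markov.
Context (R : realType) (T : R) (d : measure_display) (Omega : measurableType d)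
  (P : probability Omega R) (X : R -> Omega -> R)
  (N : nat) (a : 'I_N -> condition R)
  (d' : measure_display) (Omega' : measurableType d')
  (P' : probability Omega' R) (Y : R -> Omega' -> R).
Hypothesis T0 : 0 <= T.
Hypothesis cX : forall w, {within `[0, T], continuous (X ^~ w)}.
Hypothesis gX : gspace P (process_span `[0, T] X).
Hypothesis markovX : markov_process P T X.
Hypothesis condY : is_conditioned_process T P X a P' Y.
Implicit Types s t x : R.

Let V := augmented_process a Y.

Let cY w : {within `[0, T], continuous (Y ^~ w)}.
Proof. by have [[_ +] _] := condY; exact. Qed.

Let gSY : gspace P' (process_space `[0, T] Y) := gspace_conditioned T0 cX gX condY.

Let coord_mem (t : R) l : 0 <= t <= T ->
  process_space `[0, T] Y (augmented_coord a Y t l).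
Proof. by move=> tT; exact: augmented_coord_mem. Qed.

Lemma augmented_gaussian : gaussian_vector_process P' T V.
Proof.
move=> n i c Di; apply: cgauss_gaussian_rv; apply: gSY.2.
have lS := gSY.1.
rewrite (_ : (fun w => _) =
  \sum_k c k *: augmented_coord a Y (i k).1 (i k).2); last first.
  by apply/funext => w; rewrite fct_sumE.
apply: subspace_sum => // k; apply: subspaceZ => //; apply: coord_mem.
by have [] := Di k; rewrite /= in_itv.
Qed.

(** The coefficients found for X serve for Y: [conditioned_ip] turns the covariance with Y_x into
    that of [Q] with the residual of X_x, and this equals the covariance with X_x because [Q] is
    orthogonal to the conditions. *)
Lemma augmented_regression s t j : 0 <= s -> s <= t -> t <= T ->
  exists c : 'I_N.+1 -> R, forall m, process_space `[0, s] Y m ->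
    ip P' (augmented_coord a Y t j - \sum_l c l *: augmented_coord a Y s l) m = 0.
Proof.
move=> s0 st tT; have lS := gSY.1.
have sT : 0 <= s <= T by rewrite s0 (le_trans st).
have tT' : 0 <= t <= T by rewrite tT (le_trans s0).
have [c cE] := residual_regression a T0 cX gX markovX j s0 st tT.
exists c => m; have sub x : 0 <= x <= s -> 0 <= x <= T.
  by move=> /andP[-> xs]; apply: le_trans xs _; case/andP: sT.
have SY x : 0 <= x <= s -> process_space `[0, T] Y (Y x).
  by move=> /sub xT; apply: process_space_mem; rewrite /= in_itv.
have gSX : gspace P (process_space `[0, T] X) := gspace_pointwise_closure gX.
have lSX := gSX.1.
apply: (ip_process_space_eq0 gSY).
- apply: subspaceB => //; first exact: coord_mem.
  apply: subspace_sum => // l; apply: subspaceZ => //; exact: coord_mem.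
- apply: process_span_sub => // x /=; rewrite in_itv/=; exact: SY.
move=> x /=; rewrite in_itv/= => xs; have xT := sub _ xs.
have YxE : Y x = apply_condition T (dirac_condition x) Y.
  apply/funext => w; rewrite /apply_condition; apply/esym.
  exact: charge_integral_dirac.
have XxE : X x = apply_condition T (dirac_condition x) X.
  apply/funext => w; rewrite /apply_condition; apply/esym.
  exact: charge_integral_dirac.
pose res := residual a T0 cX gX.
have Sres b : process_space `[0, T] X (res b) by exact: residual_process_space.
have ra b i : ip P (res b) (apply_condition T (a i) X) = 0.
  exact: residual_orthogonal.
have SA b : process_space `[0, T] X (apply_condition T b X).
  exact: apply_condition_process_space.
have SYA b : process_space `[0, T] Y (apply_condition T b Y).
  exact: apply_condition_process_space.
have VE r l : 0 <= r <= T ->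
    augmented_coord a Y r l = apply_condition T (augmented_condition a r l) Y.
  by move=> rT; rewrite augmented_conditionE.
have := cE x xs; pose Q := res (augmented_condition a t j) -
  \sum_l c l *: res (augmented_condition a s l); rewrite -/res -/Q => QX.
have SQ : process_space `[0, T] X Q.
  by apply: subspaceB => //; apply: subspace_sum => // l; exact: subspaceZ.
have Qa i : ip P Q (apply_condition T (a i) X) = 0.
  rewrite (ipBl gSX)//; last first.
    by apply: subspace_sum => // l; exact: subspaceZ.
  rewrite ra [X in _ - X](ip_suml gSX)// big1 ?subrr// => l _.
  by rewrite ra mulr0.
have Qres : ip P Q (res (dirac_condition x)) = 0.
  rewrite /res /residual (ipBr gSX)//; last first.
    by apply: subspace_sum => // l; exact: subspaceZ.
  rewrite [X in X - _](_ : _ = 0); last by rewrite -XxE.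
  rewrite ipC [X in _ - X](ip_suml gSX)// sub0r big1 ?oppr0// => i _.
  by rewrite ipC Qa mulr0.
rewrite YxE VE//.
rewrite (eq_bigr (fun l => c l *: apply_condition T (augmented_condition a s l) Y));
  last first.
  by move=> l _; rewrite VE.
rewrite (ipBl gSY)//; last by apply: subspace_sum => // l; exact: subspaceZ.
rewrite (ip_suml gSY)// (conditioned_ip T0 cX gX condY) -[RHS]Qres.
rewrite [RHS](ipBl gSX)//; last first.
  by apply: subspace_sum => // l; exact: subspaceZ.
rewrite [X in _ = _ - X](ip_suml gSX)//; congr (_ - _); apply: eq_bigr => l _.
by rewrite (conditioned_ip T0 cX gX condY).
Qed.

Let tuple_sigma_family (S : set (Omega' -> R)) n (U : Omega' -> n.-tuple R) B :
  (forall l, S (fun w => tnth (U w) l)) -> measurable B ->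
  sigma_family S id (U @^-1` B).
Proof.
move=> SU mB.
pose G := g_sigma_algebraType (\bigcup_(i in S) g_sigma_algebra_preimage i).
have mU : measurable_fun (setT : set G) U.
  apply/measurable_fun_tnthP => l _ A mA; rewrite setTI.
  exact: (preimage_sigma_family (V := id) (SU l)).
by rewrite -[X in sigma_family _ _ X]setTI; exact: mU.
Qed.

Lemma augmented_markov : markov_process P' T V.
Proof.
have lS := gSY.1.
have mV t : 0 <= t <= T -> measurable_fun setT (V t).
  move=> tT; apply/measurable_fun_tnthP => l.
  exact: (gspace_measurable gSY (coord_mem l tT)).
split => [t|s t B s0 st tT mB]; first by rewrite in_itv; exact: mV.
have sT : 0 <= s <= T by rewrite s0 (le_trans st).
have tT' : 0 <= t <= T by rewrite tT (le_trans s0).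
have [c cE] := choice (fun j => augmented_regression j s0 st tT).
(* [W] is the innovation between s and t, and [phi] rebuilds V_t from V_s and [W]. *)
pose W w := [tuple (augmented_coord a Y t j -
  \sum_l c j l *: augmented_coord a Y s l) w | j < N.+1].
pose phi (z : N.+1.-tuple R * N.+1.-tuple R) : N.+1.-tuple R :=
  [tuple tnth z.2 j + \sum_l c j l * tnth z.1 l | j < N.+1].
have mphi : measurable_fun setT phi.
  apply/measurable_fun_tnthP => j.
  rewrite (_ : _ \o _ = fun z => tnth z.2 j + \sum_l c j l * tnth z.1 l); last first.
    by apply/funext => z /=; rewrite tnth_mktuple.
  apply: measurable_funD.
    exact: (measurableT_comp (measurable_tnth j) measurable_snd).
  apply: measurable_sum => l; apply: measurable_funM => //.
  exact: (measurableT_comp (measurable_tnth l) measurable_fst).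
pose C := phi @^-1` B.
have mC : measurable C by rewrite -[C]setTI; exact: mphi.
have VtE : V t @^-1` B = [set w | C (V s w, W w)].
  apply/seteqP; split => w; rewrite /C /= (_ : phi _ = V t w)//; apply: eq_from_tnth => j;
    by rewrite !tnth_mktuple !fctE fct_sumE subrK.
pose S1 := process_space `[0, s] Y.
(* The full orthogonal complement of the past in the space of Y is a linear space that contains
   every component of [W]. *)
pose S2 := [set f | process_space `[0, T] Y f /\ forall m, S1 m -> ip P' f m = 0].
have l1 : linear_subspace S1 by exact: process_space_subspace.
have s1 : S1 `<=` process_space `[0, T] Y.
  apply: process_spaceS => x /=; rewrite !in_itv/= => /andP[-> xs].
  by apply: le_trans xs _; case/andP: sT.
have s2 : S2 `<=` process_space `[0, T] Y by move=> f [].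
have l2 : linear_subspace S2.
  split; first by split; [exact: lS.1|move=> m _; exact: ip0l].
  move=> e f g [Sf f0] [Sg g0]; split; first exact: lS.2.
  move=> m S1m; rewrite (ip_linear gSY)//; last exact: s1.
  by rewrite f0// g0// mulr0 addr0.
have orth f g : S1 f -> S2 g -> ip P' f g = 0.
  by move=> S1f [_ g0]; rewrite ipC g0.
have S2W (A : set (N.+1.-tuple R)) : measurable A -> sigma_family S2 id (W @^-1` A).
  apply: tuple_sigma_family => j; split.
    rewrite (_ : (fun w => _) = augmented_coord a Y t j -
      \sum_l c j l *: augmented_coord a Y s l); last first.
      by apply/funext => w; rewrite tnth_mktuple.
    apply: subspaceB => //; first exact: coord_mem.
    by apply: subspace_sum => // l; apply: subspaceZ => //; exact: coord_mem.
  move=> m S1m; rewrite -[RHS](cE j m S1m); congr (ip P' _ m).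
  by apply/funext => w; rewrite tnth_mktuple.
have mW : measurable_fun setT W.
  move=> _ A mA; rewrite setTI; apply: (sigma_family_measurable _ (S2W A mA)).
  by move=> f [Sf _]; exact: (gspace_measurable gSY).
have S1V r : 0 <= r <= s -> forall A, measurable A -> sigma_family S1 id (V r @^-1` A).
  move=> /andP[r0 rs] A; apply: tuple_sigma_family => l.
  apply: process_spaceS (augmented_process_space a cY l (s := r) _); last first.
    by rewrite r0 (le_trans rs)//; case/andP: sT.
  by move=> x /=; rewrite !in_itv/= => /andP[-> /le_trans]; exact.
(* The running integrals up to time r are limits of combinations of Y on [0, r], so the past of V
   brings no event beyond those of [S1]. *)
have FS1 : sigma_family `[0, s] V `<=` sigma_family S1 id.
  apply: smallest_sub; first exact: smallest_sigma_algebra.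
  move=> _ [r rs [A mA <-]]; rewrite setTI; apply: S1V => //.
have indep F : F `<=` sigma_family S1 id -> forall A A', F A -> measurable A' ->
    P' (A `&` W @^-1` A') = (P' A * P' (W @^-1` A'))%E.
  move=> FS A A' /FS sA mA'.
  exact: (gspace_independence gSY l1 l2 s1 s2 orth sA (S2W _ mA')).
have mS1 : sigma_family S1 id `<=` measurable.
  move=> A; apply: sigma_family_measurable => f /s1.
  exact: (gspace_measurable gSY).
(* The version freezes V_s and averages over the independent [W]. It is a function of V_s alone, so
   it serves both sigma-algebras. *)
exists (fun w => fine (P' (W @^-1` xsection C (V s w)))); rewrite VtE; split.
- apply: independent_cond_exp => //.
  + exact: smallest_sigma_algebra.
  + by apply: subset_trans mS1.
  + by move=> A mA; apply: preimage_sigma_family => //; rewrite /= in_itv/= s0 lexx.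
  + exact: indep.
- have VS1 : g_sigma_algebra_preimage (V s) `<=` sigma_family S1 id.
    by move=> _ [A mA <-]; rewrite setTI; apply: S1V => //; rewrite s0 lexx.
  apply: independent_cond_exp => //.
  + by apply: sigma_algebra_preimage; exact: sigma_algebra_measurable.
  + by apply: subset_trans mS1.
  + by move=> A mA; exists A => //; rewrite setTI.
  + exact: indep.
Qed.

End conditioned_markov.

Theorem theorem5p1 (R : realType) (T : R) (hT : 0 < T)
  (d : measure_display) (Omega : measurableType d) (P : probability Omega R)
  (X : R -> Omega -> R)
  (X_gauss : continuous_gaussian_process P T X)
  (X_centered : centered P T X)
  (X_markov : markov_process P T X)
  (X_cov : forall s t : R, 0 < s -> s < T -> 0 < t -> t < T ->
     cov_fun P X s t <> 0%E)
  (N : nat) (a : 'I_N -> condition R)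
  (d' : measure_display) (Omega' : measurableType d')
  (P' : probability Omega' R) (XA : R -> Omega' -> R)
  (XA_cond : is_conditioned_process T P X a P' XA) :
  gaussian_vector_process P' T (augmented_process a XA) /\
  markov_process P' T (augmented_process a XA).
Proof.
have gX : gspace P (process_span `[0, T] X).
  by apply: gspace_process_span X_gauss.1 _ => t t0T; apply: X_centered.
have T0 := ltW hT; have cX := X_gauss.2.
split; first exact: (augmented_gaussian T0 cX gX XA_cond).
exact: (augmented_markov T0 cX gX X_markov XA_cond).
Qed.
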